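(* Let $(\Omega,d,\mu)$ be a metric measure space such that $\mu$ is $c$-almost continuous and $\alpha$-lower bounded (with $\mu(B(x,r))\ge r^\alpha$ for all $x\in\Omega$, $r>0$). Let $s>0$ and let $X$ be a rearrangement invariant space on $\Omega$. Then there is a constant $C>0$, independent of $f$ and $g$, such that for every $f\in M^{s,X}(\Omega)$ and every $g\in D^{s}(f)$ the following hold. 1. Suppose $s/\alpha<1$. (a) If $\underline{\alpha}_{X}>s/\alpha$, then $$\big\| t^{-s/\alpha}f^{**}(t)\big\|_{\bar X}\le C\,\|g\|_{X}.$$ (b) If $\bar{\alpha}_{X}<s/\alpha$, then $$\|f\|_{L^{\infty}}\le C\big(\|g\|_{X}+\|f\|_{L^{1}+L^{\infty}}\big).$$ 2. If $s/\alpha=1$, then $$\sup_{t>0}\phi_{X}(t)\,\frac{f^{**}(t)-f^{*}(t)}{t}\le C\,\|g\|_{X}.$$ 3. If $s/\alpha>1$, then $$\|f\|_{L^{\infty}}\le C\big(\|g\|_{X}+\|f\|_{L^{1}+L^{\infty}}\big).$$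
   Context: A metric measure space $(\Omega,d,\mu)$ is a metric space $(\Omega,d)$ with a Borel measure $\mu$ such that $0<\mu(B)<\infty$ for every ball $B(x,r)=\{y\in\Omega: d(x,y)<r\}$; it is always assumed that $\mu(\Omega)=\infty$ and $\mu(\{x\})=0$ for all $x\in\Omega$. $\mu$ is $\alpha$-lower bounded if there are $b,\alpha>0$ with $\mu(B(x,r))\ge b r^{\alpha}$ for all $x\in\Omega$, $r>0$; for simplicity one takes $b=1$. $\mu$ is $c$-almost continuous ($c\ge1$) if for every $t>0$ and every $x\in\Omega$ there is $r(x)>0$ such that $t\le\mu(B(x,r(x)))\le c\,t$ (this holds, for instance, if $r\mapsto\mu(B(x,r))$ is continuous for every $x$, or if $\mu$ is doubling). For measurable $f:\Omega\to\mathbb{R}$, $\mu_f(\lambda)=\mu\{x:|f(x)|>\lambda\}$, the decreasing rearrangement is $f^{*}(t)=\inf\{\lambda\ge0:\mu_f(\lambda)\le t\}$, and $f^{**}(t)=\frac1t\int_0^t f^{*}(z)\,dz$ for $t>0$. A rearrangement invariant (r.i.) space $X=X(\Omega)$ is a Banach function space on $(\Omega,\mu)$ (in the sense of Bennett–Sharpley) such that $g\in X$ and $f^{*}=g^{*}$ imply $f\in X$ and $\|f\|_X=\|g\|_X$. It is represented by an r.i. space $\bar X$ on $(0,\mu(\Omega))=(0,\infty)$ with Lebesgue measure, with $\|f\|_X=\|f^{*}\|_{\bar X}$. The fundamental function of $X$ is $\phi_X(t)=\|\chi_E\|_X$ for any measurable $E\subset\Omega$ with $\mu(E)=t$ (equivalently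 $\phi_X(t)=\|\chi_{(0,t)}\|_{\bar X}$). The Boyd indices of $X$ are $$\bar\alpha_X=\inf_{\sigma>1}\frac{\ln h_X(\sigma)}{\ln \sigma},\qquad \underline{\alpha}_X=\sup_{\sigma<1}\frac{\ln h_X(\sigma)}{\ln \sigma},$$ where $h_X(\sigma)$ is the norm on $\bar X$ of the dilation operator $E_\sigma f(t)=f^{*}(t/\sigma)$, $\sigma>0$. For $s>0$, $f\in M^{s,X}(\Omega)$ means that $f\in X$ and there is a non-negative measurable $g\in X$ with $$|f(x)-f(y)|\le d(x,y)^{s}(g(x)+g(y))\quad \mu\text{-a.e. }x,y\in\Omega.$$ Such a $g$ is called an $s$-gradient of $f$, and $D^{s}(f)$ denotes the collection of all $s$-gradients of $f$. *)

(* Defs.v *)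
From HB Require Import structures.
From mathcomp Require Import all_boot all_order all_algebra.
From mathcomp Require Import all_classical all_reals all_analysis.
From mathcomp Require Import measurable_realfun metric_structure.

Set Implicit Arguments.
Unset Strict Implicit.
Unset Printing Implicit Defensive.
Import Order.TTheory GRing.Theory Num.Theory.
Import numFieldNormedType.Exports.
Local Open Scope classical_set_scope.
Local Open Scope ring_scope.

(* The two structures are only put side by side on the same carrier: that the
   sigma-algebra is the Borel one is [mms_borel] below. *)
#[short(type="metricMeasurableType")]
HB.structure Definition MetricMeasurable (d : measure_display)
  (R : numDomainType) := {T of Metric R T & Measurable d T}.

Local Open Scope ereal_scope.

Section metric_measure_space.
Context (d : measure_display) (R : realType) (T : metricMeasurableType d R).
Variable mu : {measure set T -> \bar R}.

(* [ball x r] is the open ball {y | mdist x y < r}, by [ballEmdist]. *)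
Record metric_measure_space : Prop := {
  mms_borel : @measurable d T = <<s @open T >>;
  mms_ball_gt0 : forall (x : T) (r : R), (0 < r)%R -> 0 < mu (ball x r);
  mms_ball_fin : forall (x : T) (r : R), (0 < r)%R -> mu (ball x r) < +oo;
  mms_setT : mu [set: T] = +oo;
  mms_set1 : forall x : T, mu [set x] = 0 }.

Definition lower_bounded (alpha : R) : Prop :=
  forall (x : T) (r : R), (0 < r)%R -> (r `^ alpha)%:E <= mu (ball x r).

Definition almost_continuous (c : R) : Prop :=
  forall (t : R) (x : T), (0 < t)%R ->
    exists2 r : R, (0 < r)%R & t%:E <= mu (ball x r) <= (c * t)%:E.

End metric_measure_space.

Section rearrangement.
Context (d : measure_display) (T : measurableType d) (R : realType).
Variable mu : {measure set T -> \bar R}.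
Implicit Types f : T -> \bar R.

Definition distribution_function f (lambda : R) : \bar R :=
  mu [set x | lambda%:E < `|f x|].

(* The infimum of the empty set is +oo. Only t > 0 is meaningful: for t < 0
   this is +oo. *)
Definition rearr f (t : R) : \bar R :=
  ereal_inf [set lambda%:E | lambda in
    [set lambda : R | (0 <= lambda)%R /\ distribution_function f lambda <= t%:E]].

Definition rearr_avg f (t : R) : \bar R :=
  (t^-1)%:E * \int[@lebesgue_measure R]_(z in `]0%R, t[) rearr f z.

End rearrangement.

Section function_norms.
Context (d : measure_display) (T : measurableType d) (R : realType).
Variables (mu : {measure set T -> \bar R}) (rho : (T -> \bar R) -> \bar R).

Definition Mplus : set (T -> \bar R) :=
  [set f : T -> \bar R | measurable_fun [set: T] f /\ forall x, 0 <= f x].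

(* Bennett-Sharpley, axioms (P1)-(P5). Only the values of [rho] on [Mplus]
   are constrained and used. *)
Record banach_function_norm : Prop := {
  bfn_ge0 : forall f, Mplus f -> 0 <= rho f;
  bfn_eq0 : forall f, Mplus f -> rho f = 0 <-> {ae mu, forall x, f x = 0};
  bfn_scale : forall (a : R) f, (0 <= a)%R -> Mplus f ->
    rho (fun x => a%:E * f x) = a%:E * rho f;
  bfn_triangle : forall f g, Mplus f -> Mplus g ->
    rho (f \+ g) <= rho f + rho g;
  bfn_mono : forall f g, Mplus f -> Mplus g ->
    {ae mu, forall x, g x <= f x} -> rho g <= rho f;
  bfn_fatou : forall (f_ : (T -> \bar R)^nat) f,
    (forall n, Mplus (f_ n)) -> Mplus f ->
    {ae mu, forall x, nondecreasing_seq (f_ ^~ x) /\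
                      f_ n x @[n --> \oo] --> f x} ->
    rho (f_ n) @[n --> \oo] --> rho f;
  bfn_indic : forall E, measurable E -> mu E < +oo ->
    rho (EFin \o \1_E) < +oo;
  bfn_int : forall E, measurable E -> mu E < +oo ->
    exists2 C : R, (0 < C)%R &
      forall f, Mplus f -> \int[mu]_(x in E) f x <= C%:E * rho f }.

Definition norm_of (f : T -> \bar R) : \bar R := rho (abse \o f).

Definition in_space (f : T -> \bar R) : Prop :=
  measurable_fun [set: T] f /\ norm_of f < +oo.

Record ri_norm : Prop := {
  ri_bfn : banach_function_norm;
  ri_rearr : forall f g, measurable_fun [set: T] f -> in_space g ->
    (forall t : R, (0 < t)%R -> rearr mu f t = rearr mu g t) ->
    in_space f /\ norm_of f = norm_of g }.

End function_norms.

Section half_line.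
Variable R : realType.
Local Notation leb := (@lebesgue_measure R).

Lemma measurable_half_line : measurable (`]0%R, +oo[%classic : set (measurableTypeR R)).
Proof. exact: measurable_itv. Qed.

(* The measure space (0, +oo): the complement of (0, +oo) is a null set, so
   that function norms do not see the values of a function on (-oo, 0]. *)
Definition leb_half_line : {measure set (measurableTypeR R) -> \bar R} :=
  mrestr leb measurable_half_line.

Definition dilation (sigma : R) (f : R -> \bar R) (t : R) : \bar R :=
  rearr leb_half_line f (t / sigma)%R.

Variable rhobar : (R -> \bar R) -> \bar R.

Definition dilation_norm (sigma : R) : \bar R :=
  ereal_sup [set norm_of rhobar (dilation sigma f) | f in
    [set f | measurable_fun [set: measurableTypeR R] f /\ norm_of rhobar f <= 1]].

Definition upper_boyd : \bar R :=
  ereal_inf [set lne (dilation_norm sigma) * ((ln sigma)^-1)%:E |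
    sigma in [set sigma : R | (1 < sigma)%R]].

Definition lower_boyd : \bar R :=
  ereal_sup [set lne (dilation_norm sigma) * ((ln sigma)^-1)%:E |
    sigma in [set sigma : R | (0 < sigma < 1)%R]].

Definition fundamental_function (t : R) : \bar R :=
  norm_of rhobar (EFin \o \1_`]0%R, t[%classic).

End half_line.

(* [rhobar] is a representation of [rho]; for a non-atomic space of infinite
   measure it exists and is unique (Luxemburg). *)
Record represents (d : measure_display) (T : measurableType d) (R : realType)
    (mu : {measure set T -> \bar R}) (rho : (T -> \bar R) -> \bar R)
    (rhobar : (R -> \bar R) -> \bar R) : Prop := {
  repr_ri : ri_norm (leb_half_line R) rhobar;
  repr_norm : forall f : T -> \bar R, measurable_fun [set: T] f ->
    norm_of rho f = norm_of rhobar (rearr mu f) }.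

Definition norm_L1_plus_Linfty (d : measure_display) (T : measurableType d)
    (R : realType) (mu : {measure set T -> \bar R}) (f : T -> R) : \bar R :=
  ereal_inf [set z | exists g h : T -> R,
    [/\ measurable_fun [set: T] g, measurable_fun [set: T] h,
        f = (g \+ h)%R &
        z = 'N[mu]_1[EFin \o g] + 'N[mu]_+oo[EFin \o h]]].

Section hajlasz.
Context (d : measure_display) (R : realType) (T : metricMeasurableType d R).
Variables (mu : {measure set T -> \bar R}) (s : R).
Variable rho : (T -> \bar R) -> \bar R.

Definition s_gradient (f g : T -> R) : Prop :=
  [/\ in_space rho (EFin \o g), forall x, (0 <= g x)%R &
    exists2 N : set T, mu.-negligible N &
      forall x y, ~ N x -> ~ N y ->
        (`|f x - f y| <= mdist x y `^ s * (g x + g y))%R].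

Definition hajlasz_space (f : T -> R) : Prop :=
  in_space rho (EFin \o f) /\ exists g, s_gradient f g.

End hajlasz.

(* Main.v *)
Require Import Defs.
From mathcomp Require Import all_boot all_order all_algebra.
From mathcomp Require Import all_classical all_reals all_analysis.
From mathcomp Require Import measurable_realfun metric_structure ess_sup_inf.
From mathcomp Require Import zify lra ring.
Import Order.TTheory GRing.Theory Num.Theory.
Import numFieldNormedType.Exports.
Local Open Scope classical_set_scope.
Local Open Scope ring_scope.
Local Open Scope ereal_scope.

Set Implicit Arguments.
Unset Strict Implicit.
Unset Printing Implicit Defensive.

(** Let b be the quotient of s by alpha, and let F and G be the decreasing
    rearrangements of f and g. The metric and the measure enter through a
    single inequality, [rearr_gradient_le]:

      F z <= F t + K t^b G z   for 0 < z <= t, with K = 2 (3 c)^b.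

    To see it, surround almost any point x by a ball of measure between 3 t
    and 3 c t, which almost continuity provides. The lower bound on the measure
    keeps its radius below (3 c t)^(1/alpha). The sets where |f| exceeds F t
    and where g exceeds G t have measure at most t each, so the ball contains a
    point y outside both of them and outside the exceptional null set. Hence
    |f x| <= F t + (3 c t)^b (g x + G t), and the inequality follows by taking
    rearrangements.

    The remaining work concerns functions on the half-line.

    - Critical case b = 1. Averaging the inequality over z in (0, t) bounds
      the oscillation (mean of F over (0, t)) - F t by K times the integral of
      G over (0, t). The conclusion is then the classical fact that phi t times
      the mean of G over (0, t) is at most the norm of g
      ([fundamental_function_average_le]): cyclic permutations of a step
      function below G are equimeasurable, and their average is constant.

    - Boundedness. Let q bound the norm of the dilation by some sigma > 1,
      with q < sigma^b. Then G (sigma^-k) is at most q^k times the norm of g,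
      up to a constant ([rearr_geometric_bound]). The inequality between
      consecutive points sigma^-(k+1) and sigma^-k therefore telescopes to a
      geometric series of ratio q / sigma^b, which bounds F near 0 by F 1 and
      the norm of g ([rearr_bounded]). An upper Boyd index below b yields such
      sigma and q; if b > 1, then sigma = q = 2 works in every rearrangement
      invariant space, by [dilation_norm_two_le].

    - Lower Boyd index above b. Now sigma < 1 and the same inequality is
      iterated towards infinity, where F vanishes; it gives t^-b F t as a series
      of dilates of G whose norms decay geometrically ([norm_of_weighted]). To
      replace F by its mean over (0, t), cut (0, t) at the points t 2^-j. This
      dominates the weighted mean by a series of dilates of t^-b F t, with
      coefficients 2^-(j+1) 2^-b(j+1). The dilation by 2^(j+1) costs at most a
      factor 2^(j+1), and the surplus 2^-b(j+1) makes the series converge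
      ([norm_of_weighted_average]). *)

(** * Distribution functions and rearrangements *)
Section rearrangement_theory.
Context {d : measure_display} {T : measurableType d} {R : realType}.
Variable mu : {measure set T -> \bar R}.
Implicit Types (f g : T -> \bar R) (t l : R).

Lemma measurable_superlevel f (y : \bar R) : measurable_fun [set: T] f ->
  measurable [set x | y < `|f x|].
Proof.
move=> mf; rewrite -[X in measurable X]setTI.
by apply: emeasurable_fun_o_infty => //; exact: measurableT_comp.
Qed.

Lemma distribution_function_nonincreasing f l l' : measurable_fun [set: T] f ->
  (l <= l')%R -> distribution_function mu f l' <= distribution_function mu f l.
Proof.
move=> mf ll'; apply: le_measure; rewrite ?inE; try exact: measurable_superlevel.
by move=> x /=; apply: le_lt_trans; rewrite lee_fin.
Qed.

Lemma distribution_function_right_continuous f l (a : \bar R) :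
  measurable_fun [set: T] f ->
  (forall l', (l < l')%R -> distribution_function mu f l' <= a) ->
  distribution_function mu f l <= a.
Proof.
move=> mf H; rewrite /distribution_function.
pose F n := [set x | (l + n.+1%:R^-1)%:E < `|f x|].
have mF n : measurable (F n) by exact: measurable_superlevel.
have -> : [set x | l%:E < `|f x|] = \bigcup_n F n.
  apply/seteqP; split => x /=; last first.
    move=> [n _] /=; apply: le_lt_trans; rewrite lee_fin lerDl invr_ge0//.
  (* If l < |f x|, then l + 1/(n+1) is still below |f x| for large n. *)
  case E : `|f x| => [r| |] //; last by exists 0%N => //=; rewrite /F /= E ltry.
  rewrite lte_fin => lr.
  have /ltr_add_invr[n lnr] := lr.
  by exists n => //; rewrite /F/= E lte_fin.
have mUF : measurable (\bigcup_n F n) by exact: bigcup_measurable.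
have ndF : nondecreasing_seq F.
  move=> m n mn; apply/subsetPset => x /=; apply: le_lt_trans.
  by rewrite lee_fin lerD2l lef_pV2 ?posrE// ler_nat ltnS.
have cv := @nondecreasing_cvg_mu _ _ _ mu _ mF mUF ndF.
rewrite -(cvg_lim _ cv)//; apply: lime_le; first by apply/cvg_ex; eexists; exact: cv.
by apply: nearW => n; apply: H; rewrite ltrDl invr_gt0.
Qed.

(** The infimum defining the rearrangement is attained, by right continuity of
    the distribution function. Thus the two functions are adjoint to each
    other, and comparisons of rearrangements reduce to comparisons of
    measures. *)
Lemma rearr_leE f t l : measurable_fun [set: T] f -> (0 <= l)%R ->
  (rearr mu f t <= l%:E) = (distribution_function mu f l <= t%:E).
Proof.
move=> mf l0; apply/idP/idP => [ftl|]; last first.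
  by move=> h; apply: ereal_inf_lbound; exists l.
apply: distribution_function_right_continuous => // l' ll'.
have : rearr mu f t < l'%:E by rewrite (le_lt_trans ftl)// lte_fin.
move=> /ereal_inf_lt[_ [r [r0 fr] <-]]; rewrite lte_fin => rl'.
by apply: le_trans fr; apply: distribution_function_nonincreasing => //; exact: ltW.
Qed.

Lemma rearr_ge0 f t : 0 <= rearr mu f t.
Proof. by apply: le_ereal_inf_tmp => _ [l [l0 _] <-]; rewrite lee_fin. Qed.

Lemma rearr_nonincreasing f t t' : (t <= t')%R -> rearr mu f t' <= rearr mu f t.
Proof.
move=> tt'; apply: ereal_inf_le_tmp => _ [l [l0 lt] <-]; exists l => //; split => //.
by apply: le_trans lt _; rewrite lee_fin.
Qed.

(** These sets of controlled measure are the ones that good points have to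
    avoid in [exists_good_point]. *)
Lemma measure_gt_rearr f t : measurable_fun [set: T] f -> (0 <= t)%R ->
  mu [set x | rearr mu f t < `|f x|] <= t%:E.
Proof.
move=> mf t0; case E : (rearr mu f t) => [r| |]; last 2 first.
- rewrite (_ : [set _ | _] = set0) ?measure0 ?lee_fin// -subset0 => x/=.
  by rewrite ltNge leey.
- by have := rearr_ge0 f t; rewrite E.
have r0 : (0 <= r)%R by rewrite -lee_fin -E rearr_ge0.
by have := rearr_leE t mf r0; rewrite E lexx => /esym.
Qed.

End rearrangement_theory.

Lemma le_rearr {d d'} {T : measurableType d} {T' : measurableType d'} {R : realType}
    (mu : {measure set T -> \bar R}) (nu : {measure set T' -> \bar R})
    (f : T -> \bar R) (g : T' -> \bar R) (t t' : R) :
  (forall l, (0 <= l)%R -> distribution_function nu g l <= t'%:E ->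
     distribution_function mu f l <= t%:E) ->
  rearr mu f t <= rearr nu g t'.
Proof.
move=> H; apply: ereal_inf_le_tmp => _ [l [l0 lt] <-]; exists l => //; split => //.
exact: H.
Qed.

Lemma nonincreasing_measurable_ereal {R : realType} (f : R -> \bar R) :
  (forall x y, (x <= y)%R -> f y <= f x) ->
  measurable_fun [set: measurableTypeR R] f.
Proof.
move=> nf; apply: (measurability _ (ErealGenOInfty.measurableE R)) => //.
move=> _ [_ [x ->] <-]; apply: measurableI => //.
apply: is_interval_measurable => s t/= fs ft u /andP[su ut].
move: ft; rewrite /= !in_itv/= !andbT => ft.
by rewrite (lt_le_trans ft)// nf.
Qed.

Lemma nondecreasing_measurable_ereal {R : realType} (f : R -> \bar R) :
  (forall x y, (x <= y)%R -> f x <= f y) ->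
  measurable_fun [set: measurableTypeR R] f.
Proof.
move=> nf; apply: (measurability _ (ErealGenOInfty.measurableE R)) => //.
move=> _ [_ [x ->] <-]; apply: measurableI => //.
apply: is_interval_measurable => s t/= fs ft u /andP[su ut].
move: fs; rewrite /= !in_itv/= !andbT => fs.
by rewrite (lt_le_trans fs)// nf.
Qed.

Lemma measurable_rearr {d} {T : measurableType d} {R : realType}
    (mu : {measure set T -> \bar R}) (f : T -> \bar R) :
  measurable_fun [set: measurableTypeR R] (rearr mu f).
Proof. by apply: nonincreasing_measurable_ereal => x y; exact: rearr_nonincreasing. Qed.

(** * Lebesgue measure on the half-line *)
Section half_line_measure.
Context {R : realType}.
Implicit Types (P : R -> Prop) (F : R -> \bar R).

Lemma leb_half_lineE (A : set R) :
  leb_half_line R A = @lebesgue_measure R (A `&` `]0%R, +oo[).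
Proof. by []. Qed.

Lemma ae_half_line P : (forall x, (0 < x)%R -> P x) ->
  {ae leb_half_line R, forall x, P x}.
Proof.
move=> H; exists (`]-oo, 0%R]%classic); split => //.
- rewrite leb_half_lineE (_ : _ `&` _ = set0) ?measure0 // -subset0 => x /= [].
  by rewrite !in_itv/= andbT => x0; rewrite ltNge x0.
- move=> x /= nP; rewrite in_itv/= leNgt; apply/negP => x0.
  by apply: nP; exact: H.
Qed.

(** The image measure agrees with Lebesgue measure on intervals, which
    determine it. *)
Lemma lebesgue_measure_shift (e : R) (A : set (measurableTypeR R)) : measurable A ->
  @lebesgue_measure R [set x | A (x + e)%R] = @lebesgue_measure R A.
Proof.
move=> mA.
have mphi : measurable_fun [set: measurableTypeR R]
    ((fun x => x + e)%R : measurableTypeR R -> measurableTypeR R).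
  by apply: measurable_funD => //; exact: measurable_cst.
apply/esym.
apply: (@lebesgue_measure_unique R
  (pushforward (@lebesgue_measure R) ((fun x => x + e)%R : measurableTypeR R -> measurableTypeR R))) => //.
move=> _ [[a b]] _ <-.
rewrite /pushforward [X in _ = lebesgue_measure X](_ : _ = `]a - e, b - e]%classic)%R; last first.
  by apply/seteqP; split => x /=; rewrite !in_itv/= ltrBlDr lerBrDr.
rewrite !lebesgue_measure_itv/= !lte_fin ltrD2r.
by case: ifP => // _; rewrite -!EFinB; congr EFin; ring.
Qed.

End half_line_measure.

Lemma measurable_dilate {R : realType} (F : measurableTypeR R -> \bar R) (a : R) :
  measurable_fun [set: measurableTypeR R] F ->
  measurable_fun [set: measurableTypeR R] (fun t => F (t / a)%R).
Proof.
move=> mF; apply: (measurableT_comp mF).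
by apply: measurable_funM => //; exact: measurable_cst.
Qed.

(** The superlevel sets of the dilated rearrangement are the intervals from 0
    to sigma times the measure of the superlevel sets of f. With sigma = 1, a
    rearrangement is its own rearrangement; in general, dilations compose on
    rearrangements as they should. *)
Lemma rearr_dilate {d} {T : measurableType d} {R : realType}
    (mu : {measure set T -> \bar R}) (f : T -> \bar R) (sigma t : R) :
  measurable_fun [set: T] f -> (0 < sigma)%R -> (0 < t)%R ->
  rearr (leb_half_line R) (fun z => rearr mu f (z / sigma)) t =
  rearr mu f (t / sigma).
Proof.
move=> mf s0 t0.
have key l : (0 <= l)%R ->
    (distribution_function (leb_half_line R) (fun z => rearr mu f (z / sigma)) l
       <= t%:E) = (distribution_function mu f l <= (t / sigma)%:E).
  move=> l0; rewrite {1}/distribution_function.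
  set m := distribution_function mu f l.
  have -> : leb_half_line R [set x | l%:E < `|rearr mu f (x / sigma)|] =
      @lebesgue_measure R [set x | (0 < x)%R /\ (x / sigma)%:E < m].
    rewrite leb_half_lineE; congr (@lebesgue_measure R _).
    apply/seteqP; split => x /=; rewrite in_itv/= andbT gee0_abs ?rearr_ge0//.
   by move=> [h ->]; split => //; rewrite ltNge /m -rearr_leE// -ltNge.
    by move=> [-> h]; split => //; rewrite ltNge rearr_leE// -ltNge -/m.
  rewrite -/m; have m0 : 0 <= m by exact: measure_ge0.
  case: m m0 => [r| |] // r0; last first.
    have -> : [set x | (0 < x)%R /\ (x / sigma)%:E < +oo] = `]0%R, +oo[%classic :> set R.
      apply/seteqP; split => x /=; rewrite in_itv/= andbT; first by case.
      by move=> ->; split => //; rewrite ltry.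
    by rewrite lebesgue_measure_itv/= ltry/= !leye_eq.
  have -> : [set x | (0 < x)%R /\ (x / sigma)%:E < r%:E] =
      `]0%R, (r * sigma)%R[%classic :> set R.
    apply/seteqP; split => x /=; rewrite in_itv/= lte_fin ltr_pdivrMr//.
      by move=> [-> ->].
    by move=> /andP[].
  rewrite lebesgue_measure_itv/= lte_fin; rewrite lee_fin in r0.
  case: ifPn => [_|]; first by rewrite -EFinB subr0 !lee_fin ler_pdivlMr.
  rewrite -leNgt !lee_fin => rs.
  have -> : r = 0%R.
    by apply/eqP; rewrite eq_le r0 andbT; move: rs; rewrite pmulr_lle0.
  by rewrite divr_ge0// ltW.
by apply/eqP; rewrite eq_le; apply/andP; split; apply: le_rearr => l /key ->.
Qed.

(** * Rearrangement invariant norms on the half-line *)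
Section ri_norm_half_line.
Context {R : realType} (rhobar : (R -> \bar R) -> \bar R).
Hypothesis hri : ri_norm (leb_half_line R) rhobar.
Implicit Types F G : measurableTypeR R -> \bar R.

Let hbfn : banach_function_norm (leb_half_line R) rhobar := ri_bfn hri.

Lemma Mplus_abse F : measurable_fun [set: measurableTypeR R] F ->
  Mplus (abse \o F).
Proof. by move=> mF; split => [|x]; [exact: measurableT_comp|exact: abse_ge0]. Qed.

Lemma norm_of_ge0 F : measurable_fun [set: measurableTypeR R] F ->
  0 <= norm_of rhobar F.
Proof. by move=> mF; apply: (bfn_ge0 hbfn); exact: Mplus_abse. Qed.

Lemma norm_of_nonneg F : (forall x, 0 <= F x) -> norm_of rhobar F = rhobar F.
Proof.
by move=> F0; congr rhobar; apply/funext => x /=; rewrite gee0_abs.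
Qed.

Lemma le_norm_of F G :
  measurable_fun [set: measurableTypeR R] F ->
  measurable_fun [set: measurableTypeR R] G ->
  (forall x, (0 < x)%R -> `|F x| <= `|G x|) ->
  norm_of rhobar F <= norm_of rhobar G.
Proof.
move=> mF mG FG; apply: (bfn_mono hbfn); try exact: Mplus_abse.
exact: ae_half_line.
Qed.

Lemma norm_of_scale (a : R) F : (0 <= a)%R ->
  measurable_fun [set: measurableTypeR R] F ->
  norm_of rhobar (fun x => a%:E * F x) = a%:E * norm_of rhobar F.
Proof.
move=> a0 mF; rewrite /norm_of -(bfn_scale hbfn a0 (Mplus_abse mF)).
by congr rhobar; apply/funext => x /=; rewrite abseM gee0_abs.
Qed.

Lemma norm_of_sum n (F : 'I_n -> measurableTypeR R -> \bar R) :
  (forall i, Mplus (F i)) ->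
  norm_of rhobar (fun x => \sum_(i < n) F i x) <= \sum_(i < n) norm_of rhobar (F i).
Proof.
move=> mF.
have -> : (fun x => \sum_(i < n) F i x) = \big[(fun f g => f \+ g)/(fun=> 0)]_(i < n) F i.
  apply/funext => x; elim/big_ind2 : _ => // a f b g <- <- //.
suff [] : Mplus (\big[(fun f g => f \+ g)/(fun=> 0)]_(i < n) F i) /\
  norm_of rhobar (\big[(fun f g => f \+ g)/(fun=> 0)]_(i < n) F i) <=
     \sum_(i < n) norm_of rhobar (F i) by [].
elim/big_ind2 : _ => [|a f b g [Mf fa] [Mg gb]|i _]; last by split.
  split; first by split => [|x //]; exact: measurable_cst.
  rewrite norm_of_nonneg//.
  have -> : (fun=> 0 : \bar R) = (fun x : measurableTypeR R => 0%:E * 0).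
    by apply/funext => x; rewrite mule0.
  rewrite (@bfn_scale _ _ _ _ _ hbfn 0%R) ?mul0e//.
have Mfg : Mplus (f \+ g).
  by case: Mf Mg => mf f0 [mg g0]; split => [|x]; [exact: emeasurable_funD|exact: adde_ge0].
split => //; apply: le_trans (leeD fa gb).
case: Mf Mg Mfg => mf f0 [mg g0] [mfg fg0].
by rewrite !norm_of_nonneg//; apply: (bfn_triangle hbfn).
Qed.

(** Countable subadditivity: the Fatou property turns finite subadditivity of
    the norm of partial sums into a bound for the norm of the sum. *)
Lemma norm_of_series (F : nat -> measurableTypeR R -> \bar R) :
  (forall i, Mplus (F i)) ->
  norm_of rhobar (fun x => \sum_(0 <= i <oo) F i x) <=
  \sum_(0 <= i <oo) norm_of rhobar (F i).
Proof.
move=> mF.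
have F0 i x : 0 <= F i x by case: (mF i) => _; apply.
have nF0 i : 0 <= norm_of rhobar (F i) by apply: norm_of_ge0; case: (mF i).
have S0 n x : 0 <= \sum_(0 <= i < n) F i x by exact: sume_ge0.
have MS n : Mplus (fun x => \sum_(0 <= i < n) F i x).
  by split => // ; apply: emeasurable_sum => i; case: (mF i).
have MSoo : Mplus (fun x => \sum_(0 <= i <oo) F i x).
  split => [|x]; last by apply: nneseries_ge0.
  by apply: ge0_emeasurable_sum => // k _; case: (mF k).
have cv : rhobar (fun x => \sum_(0 <= i < n) F i x) @[n --> \oo] -->
    rhobar (fun x => \sum_(0 <= i <oo) F i x).
  apply: (bfn_fatou hbfn) => //; apply: ae_half_line => x _; split.
    by apply: ereal_nondecreasing_series.
  by apply: is_cvg_nneseries.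
rewrite norm_of_nonneg; last by case: MSoo.
rewrite -(cvg_lim _ cv)//; apply: lime_le; first by apply/cvg_ex; eexists; exact: cv.
apply: nearW => n; apply: le_trans (nneseries_lim_ge n _) => //.
rewrite -norm_of_nonneg// !big_mkord.
under [X in norm_of _ X]eq_fun do rewrite big_mkord.
exact: norm_of_sum.
Qed.

Lemma norm_of_le_series (G : measurableTypeR R -> \bar R)
    (H : nat -> measurableTypeR R -> \bar R) :
  measurable_fun [set: measurableTypeR R] G -> (forall i, Mplus (H i)) ->
  (forall x, 0 <= G x) ->
  (forall x, (0 < x)%R -> G x <= \sum_(0 <= i <oo) H i x) ->
  norm_of rhobar G <= \sum_(0 <= i <oo) norm_of rhobar (H i).
Proof.
move=> mG MH G0 GH; apply: le_trans (norm_of_series MH).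
apply: le_norm_of => //.
  by apply: ge0_emeasurable_sum => [k x _ _|k _]; case: (MH k).
move=> x x0; rewrite !gee0_abs//; first exact: GH.
by apply: nneseries_ge0 => k _ _; case: (MH k).
Qed.

(** By [rearr_dilate] a function on the half-line is equimeasurable with its
    rearrangement. Invariance presupposes that one of the two norms is finite,
    and it applies in either direction, so both are finite or both infinite. *)
Lemma norm_of_rearr F : measurable_fun [set: measurableTypeR R] F ->
  norm_of rhobar (rearr (leb_half_line R) F) = norm_of rhobar F.
Proof.
move=> mF; set F' := rearr _ F.
have mF' : measurable_fun [set: measurableTypeR R] F' by exact: measurable_rearr.
have E t : (0 < t)%R -> rearr (leb_half_line R) F' t = rearr (leb_half_line R) F t.
  move=> t0; have := rearr_dilate (leb_half_line R) mF ltr01 t0.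
  by rewrite divr1; under [X in rearr _ X]eq_fun do rewrite divr1.
have [lF|] := ltP (norm_of rhobar F) +oo.
  have iF : in_space rhobar F by split.
  by have [] := ri_rearr hri mF' iF E.
rewrite leye_eq => /eqP nF.
have [lF'|] := ltP (norm_of rhobar F') +oo; last by rewrite leye_eq => /eqP ->.
have iF' : in_space rhobar F' by split.
by have [_ /esym] := ri_rearr hri mF iF' (fun t t0 => esym (E t t0)).
Qed.

(** Smaller superlevel sets give a pointwise smaller rearrangement. This is how
    functions that are merely permuted or thinned out are compared below. *)
Lemma le_norm_of_distribution F G :
  measurable_fun [set: measurableTypeR R] F ->
  measurable_fun [set: measurableTypeR R] G ->
  (forall l, (0 <= l)%R ->
    distribution_function (leb_half_line R) F l <=
    distribution_function (leb_half_line R) G l) ->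
  norm_of rhobar F <= norm_of rhobar G.
Proof.
move=> mF mG FG; rewrite -(norm_of_rearr mF) -(norm_of_rearr mG).
apply: le_norm_of; try exact: measurable_rearr.
move=> x _; rewrite !gee0_abs ?rearr_ge0//; apply: le_rearr => l l0.
exact/le_trans/FG.
Qed.

Lemma measurable_indic_oo (t : R) :
  measurable_fun [set: measurableTypeR R] (EFin \o (\1_`]0%R, t[%classic : R -> R)).
Proof.
apply/measurable_EFinP; exact: measurable_indic (measurable_itv _).
Qed.

Lemma fundamental_function_gt0 (t : R) : (0 < t)%R ->
  0 < fundamental_function rhobar t.
Proof.
move=> t0; have mI := measurable_indic_oo t.
rewrite lt0e (norm_of_ge0 mI) andbT; apply/negP => /eqP.
move=> /(bfn_eq0 hbfn (Mplus_abse mI))[N [mN N0 sN]].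
have : leb_half_line R `]0%R, t[%classic <= leb_half_line R N.
  apply: le_measure; rewrite ?inE//.
  move=> x /= x0t; apply: sN => /=.
  by rewrite indicE mem_set// normr1 => /eqP; rewrite eqe oner_eq0.
rewrite N0 leb_half_lineE (_ : _ `&` _ = `]0%R, t[%classic).
  by rewrite lebesgue_measure_itv/= lte_fin t0 -EFinB subr0 lee_fin leNgt t0.
by apply/seteqP; split => x /=; rewrite !in_itv/= ?andbT; [case|move=> /andP[-> ->]].
Qed.

Lemma fundamental_function_fin (t : R) : fundamental_function rhobar t < +oo.
Proof.
rewrite /fundamental_function norm_of_nonneg; last by move=> x; rewrite lee_fin.
apply: (bfn_indic hbfn); first exact: measurable_itv.
rewrite leb_half_lineE.
apply: (@le_lt_trans _ _ (@lebesgue_measure R `]0%R, t[%classic)).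
  by apply: measureIl; exact: measurable_itv.
by rewrite lebesgue_measure_itv/=; case: ifP => _; rewrite ltry.
Qed.

(** The constant may be +oo, in which case the norm is infinite: the inequality
    is first shown for all real constants below y. *)
Lemma const_le_norm_of (y : \bar R) (t : R) F :
  measurable_fun [set: measurableTypeR R] F -> 0 <= y -> (0 < t)%R ->
  (forall x, (0 < x < t)%R -> y <= `|F x|) ->
  y * fundamental_function rhobar t <= norm_of rhobar F.
Proof.
move=> mF y0 t0 yF.
have mI := measurable_indic_oo t.
have key (r : R) : (0 <= r)%R -> r%:E <= y ->
    r%:E * fundamental_function rhobar t <= norm_of rhobar F.
  move=> r0 ry; rewrite -norm_of_scale//; apply: le_norm_of => //.
    by apply: measurable_funeM.
  move=> x x0 /=; have [xt|xt] := pselect (`]0%R, t[%classic x).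
    by rewrite indicE mem_set//= mulr1 ger0_norm// (le_trans ry)// yF//; move: xt; rewrite /= in_itv.
  by rewrite indicE memNset//= mulr0 normr0 abse_ge0.
case: y y0 yF key => [r| |] // y0 _ key; first exact: key.
have phi0 := fundamental_function_gt0 t0.
have phioo := fundamental_function_fin t.
have phin : fundamental_function rhobar t \is a fin_num by rewrite ge0_fin_numE// ltW.
rewrite gt0_mulye// leye_eq; apply/eqP/eqyP => A A0.
have f0 : (0 < fine (fundamental_function rhobar t))%R by rewrite fine_gt0// phi0.
have := key (A / fine (fundamental_function rhobar t))%R
  (divr_ge0 (ltW A0) (ltW f0)) (leey _).
by rewrite -{2}(fineK phin) -EFinM divfK ?gt_eqF.
Qed.

End ri_norm_half_line.

(** * The dilation by two has norm at most two *)
(** S and its translate S - e fit disjointly into [0, M]. *)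
Lemma measure_shift_disjoint {R : realType} (e M : R) (S : set (measurableTypeR R)) :
  measurable S -> (0 <= M)%R -> (0 < e)%R ->
  (forall x, S x -> (e <= x <= M)%R) -> (forall x, S x -> ~ S (x + e)%R) ->
  @lebesgue_measure R S <= (M / 2)%:E.
Proof.
move=> mS M0 e0 SM Sdisj; pose S' : set (measurableTypeR R) := [set x | S (x + e)%R].
have mS' : measurable S'.
  have mphi : measurable_fun [set: measurableTypeR R]
      ((fun x => x + e)%R : measurableTypeR R -> measurableTypeR R).
    by apply: measurable_funD => //; exact: measurable_cst.
  by have := mphi measurableT S mS; rewrite setTI.
have SS' : S `&` S' = set0 by rewrite -subset0 => x [/Sdisj].
have /= le2 : @lebesgue_measure R (S `|` S') <= M%:E.
  apply: (@le_trans _ _ (@lebesgue_measure R `[0%R, M]%classic)).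
    apply: le_measure; rewrite ?inE//; first exact: measurableU.
    move=> x []; first by move=> /SM /andP[ex xM]; rewrite /= in_itv/=; lra.
    by move=> /SM /andP[ex xM]; rewrite /= in_itv/=; lra.
  rewrite lebesgue_measure_itv/= lte_fin; case: ifP => _; last by rewrite lee_fin.
  by rewrite -EFinB subr0.
have E : @lebesgue_measure R (S `|` S') = @lebesgue_measure R S + @lebesgue_measure R S.
  by rewrite measureU//; congr (_ + _); exact: lebesgue_measure_shift.
have half (m : \bar R) : 0 <= m -> m + m <= M%:E -> m <= (M / 2)%:E.
  by case: m => [r| |] //=; rewrite -EFinD !lee_fin => _; lra.
by apply: half; [exact: measure_ge0|rewrite -E].
Qed.

Section dilation_by_two.
Context {R : realType} (rhobar : (R -> \bar R) -> \bar R).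
Hypothesis hri : ri_norm (leb_half_line R) rhobar.

(** With i = 0 and i = 1, the intervals [j e, (j + 1) e[ for odd j and for even
    j > 0. Leaving out [0, e[ ensures that a block shifted down by e stays in
    the half-line, so that neither family fills more than half of any [0, M]. *)
Definition block (e : R) (i : nat) : set (measurableTypeR R) :=
  \bigcup_k `[((k.*2 + i).+1%:R * e)%R, ((k.*2 + i).+2%:R * e)%R[%classic.

Lemma measurable_block e i : measurable (block e i).
Proof. by apply: bigcup_measurable => k _; exact: measurable_itv. Qed.

Lemma block_ge e i x : (0 < e)%R -> block e i x -> (e <= x)%R.
Proof.
move=> e0 [k _ /=]; rewrite in_itv/= => /andP[+ _]; apply: le_trans.
apply: ler_peMl; [exact: ltW|by rewrite ler1n].
Qed.

Lemma block_shift e i x : (0 < e)%R -> block e i x -> ~ block e i (x + e)%R.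
Proof.
move=> e0 [k _ /=]; rewrite in_itv/= => /andP[k1 k2].
move=> [j _ /=]; rewrite in_itv/= => /andP[j1 j2].
have : ((k.*2 + i).+2%:R * e < (j.*2 + i).+2%:R * e :> R)%R.
  apply: le_lt_trans j2; rewrite -[X in (X * e)%R]natr1 mulrDl mul1r lerD2r//.
have : ((j.*2 + i).+1%:R * e < (k.*2 + i).+3%:R * e :> R)%R.
  apply: le_lt_trans j1 _; rewrite -[X in (_ < X * e)%R]natr1 mulrDl mul1r ltrD2r//.
rewrite !ltr_pM2r// !ltr_nat; lia.
Qed.

Lemma block_cover e x : (0 < e)%R -> (e <= x)%R -> block e 0 x \/ block e 1 x.
Proof.
move=> e0 ex; pose n := Num.truncn (x / e).
have xe0 : (0 <= x / e)%R by rewrite divr_ge0 ?(le_trans (ltW e0))// ltW.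
have /andP[n1 n2] := truncn_itv xe0.
have n0 : (0 < n)%N by rewrite truncn_ge_nat// ler_pdivlMr// mul1r.
have xn : (n%:R * e <= x < n.+1%:R * e)%R.
  by rewrite -ler_pdivlMr// n1/= -ltr_pdivrMr.
have nE : n = (odd n.-1 + n.-1./2.*2).+1 by rewrite odd_double_half prednK.
case E : (odd n.-1); [right|left]; exists n.-1./2 => //=; rewrite in_itv/= addnC.
  by move: nE; rewrite E/= => <-.
by move: nE; rewrite E/= => <-.
Qed.

(** The superlevel sets of the dilated function have length twice those of F.
    Restricted to blocks of one parity, they are disjoint from their translates
    by e, hence at least half of that length is lost. *)
Lemma distribution_block (F : measurableTypeR R -> \bar R) (e l : R) (i : nat) :
  measurable_fun [set: measurableTypeR R] F -> (forall x, 0 <= F x) ->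
  (forall x y, (0 < x)%R -> (x <= y)%R -> F y <= F x) -> (0 < e)%R -> (0 <= l)%R ->
  distribution_function (leb_half_line R)
    (fun t => F (t / 2)%R * (\1_(block e i) t)%:E) l <=
  distribution_function (leb_half_line R) F l.
Proof.
move=> mF F0 Fni e0 l0.
set m := distribution_function _ F l; rewrite /distribution_function leb_half_lineE.
have m0 : 0 <= m by exact: measure_ge0.
have msub (x : R) : (0 < x)%R -> l%:E < F x -> x%:E <= m.
  move=> x0 lx; rewrite /m /distribution_function leb_half_lineE.
  apply: (@le_trans _ _ (@lebesgue_measure R `]0%R, x]%classic)).
    by rewrite lebesgue_measure_itv/= lte_fin x0 -EFinB subr0.
  apply: le_measure; rewrite ?inE.
  - exact: measurable_itv.
  - by apply: measurableI; [exact: measurable_superlevel|exact: measurable_itv].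
  move=> y /=; rewrite !in_itv/= andbT => /andP[y0 yx]; split => //.
  by rewrite gee0_abs// (lt_le_trans lx)// Fni.
case: m m0 msub => [m| |] // m0 msub; last by rewrite leey.
rewrite lee_fin in m0.
have mG : measurable_fun [set: measurableTypeR R]
    (fun t => F (t / 2)%R * (\1_(block e i) t)%:E).
  apply: emeasurable_funM.
    exact: measurable_dilate.
  by apply/measurable_EFinP; apply: measurable_indic; exact: measurable_block.
have := @measure_shift_disjoint R e (2 * m)%R
  ([set x | l%:E < `|F (x / 2)%R * (\1_(block e i) x)%:E|] `&` `]0%R, +oo[%classic).
rewrite (_ : 2 * m / 2 = m)%R; last by field.
have SB x : ([set x | l%:E < `|F (x / 2)%R * (\1_(block e i) x)%:E|] `&` `]0%R, +oo[%classic) x ->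
    block e i x /\ (x <= 2 * m)%R.
  rewrite /= in_itv/= andbT => -[+ x0].
  have [xb|xb] := pselect (block e i x); last first.
    by rewrite indicE memNset// mule0 abse0 lte_fin ltNge l0.
  rewrite indicE mem_set// mule1 gee0_abs// => lF; split => //.
  have := msub (x / 2)%R; rewrite divr_gt0// => /(_ isT lF).
  by rewrite lee_fin; lra.
apply => //.
- by apply: measurableI; [exact: measurable_superlevel|exact: measurable_itv].
- by rewrite mulr_ge0.
- by move=> x /SB[/(block_ge e0) -> ->].
- by move=> x /SB[/(block_shift e0) xb _] /SB[].
Qed.

(** On [e, +oo[ the dilated function is the sum of its restrictions to the odd
    and to the even blocks, each of norm at most that of F. Then e tends to 0,
    by the Fatou property. *)
Lemma norm_of_dilate_two (F : measurableTypeR R -> \bar R) :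
  measurable_fun [set: measurableTypeR R] F -> (forall x, 0 <= F x) ->
  (forall x y, (0 < x)%R -> (x <= y)%R -> F y <= F x) ->
  norm_of rhobar (fun t => F (t / 2)%R) <= 2%:E * norm_of rhobar F.
Proof.
move=> mF F0 Fni; pose G t := F (t / 2)%R.
have mG : measurable_fun [set: measurableTypeR R] G.
  exact: measurable_dilate.
have mI (A : set (measurableTypeR R)) : measurable A -> Mplus (fun t => G t * (\1_A t)%:E).
  move=> mA; split => [|x]; last by rewrite mule_ge0 ?F0// lee_fin.
  by apply: emeasurable_funM => //; apply/measurable_EFinP; exact: measurable_indic.
pose e n : R := n.+1%:R^-1%R.
have e0 n : (0 < e n)%R by rewrite invr_gt0.
pose G_ n t := G t * (\1_(`[e n, +oo[%classic) t)%:E.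
have MG n : Mplus (G_ n) by apply: mI; exact: measurable_itv.
have cv : rhobar (G_ n) @[n --> \oo] --> rhobar G.
  apply: (bfn_fatou (ri_bfn hri)) => //.
    by split => // x; exact: F0.
  apply: ae_half_line => x x0; split.
    apply/nondecreasing_seqP => n; rewrite /G_ lee_wpmul2l ?F0// lee_fin.
    have [xn|xn] := pselect (`[e n, +oo[%classic x); last by rewrite [X in (X <= _)%R]indicE memNset.
    rewrite !indicE !mem_set//; move: xn; rewrite /= !in_itv/= !andbT.
    by apply: le_trans; rewrite lef_pV2 ?posrE// ler_nat.
  apply: cvg_near_cst; have /ltr_add_invr[N] := x0; rewrite add0r => Nx.
  exists N => // n /= Nn; rewrite /G_ indicE mem_set ?mule1//= in_itv/= andbT.
  by apply: le_trans (ltW Nx); rewrite lef_pV2 ?posrE// ler_nat ltnS.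
rewrite [leLHS]norm_of_nonneg//.
rewrite -(cvg_lim _ cv)//; apply: lime_le; first by apply/cvg_ex; eexists; exact: cv.
apply: nearW => n.
pose H i := (fun t => G t * (\1_(block (e n) i) t)%:E).
have MH i : Mplus (H i) by apply: mI; exact: measurable_block.
have HF i : norm_of rhobar (H i) <= norm_of rhobar F.
  apply: (le_norm_of_distribution hri) => //; first by case: (MH i).
  by move=> l l0; exact: distribution_block.
have -> : 2%:E * norm_of rhobar F = norm_of rhobar F + norm_of rhobar F.
  by rewrite -mule2n -mule_natl.
apply: (@le_trans _ _ (rhobar (H 0%N \+ H 1%N))); last first.
  apply: le_trans (leeD (HF 0%N) (HF 1%N)).
  have H0 i y : 0 <= H i y by case: (MH i).
  rewrite (norm_of_nonneg _ (H0 0%N)) (norm_of_nonneg _ (H0 1%N)).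
  apply: (bfn_triangle (ri_bfn hri)); exact: MH.
have MHH : Mplus (H 0%N \+ H 1%N).
  case: (MH 0%N) (MH 1%N) => ? H0 [? H1]; split => [|x].
    exact: emeasurable_funD.
  exact: adde_ge0.
apply: (bfn_mono (ri_bfn hri)); [exact: MHH|exact: MG|apply: ae_half_line => x x0].
have H0 i y : 0 <= H i y by case: (MH i).
have [xn|xn] := pselect (`[e n, +oo[%classic x); last first.
  by rewrite /G_ indicE memNset// mule0; apply: adde_ge0; exact: H0.
rewrite /G_ indicE mem_set// mule1.
move: xn; rewrite /= in_itv/= andbT => /(block_cover (e0 n))[b|b].
  apply: le_trans (leeDl _ (H0 1%N x)).
  by rewrite /H indicE mem_set// mule1.
apply: le_trans (leeDr _ (H0 0%N x)).
by rewrite /H indicE mem_set// mule1.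
Qed.

Lemma norm_of_dilate_two_iter k (F : measurableTypeR R -> \bar R) :
  measurable_fun [set: measurableTypeR R] F -> (forall x, 0 <= F x) ->
  (forall x y, (0 < x)%R -> (x <= y)%R -> F y <= F x) ->
  norm_of rhobar (fun t => F (t / 2 ^+ k)%R) <= (2 ^+ k)%:E * norm_of rhobar F.
Proof.
move=> mF F0 Fni; elim: k => [|k ih].
  by rewrite expr0 mul1e; under eq_fun do rewrite divr1.
have mG : measurable_fun [set: measurableTypeR R] (fun t => F (t / 2 ^+ k)%R).
  exact: measurable_dilate.
have := norm_of_dilate_two mG (fun x => F0 _).
have -> : (fun t => F (t / 2 / 2 ^+ k)%R) = (fun t => F (t / 2 ^+ k.+1)%R).
  by apply/funext => x; congr F; rewrite exprS invfM mulrA.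
move=> /(_ _)/le_trans; apply.
  move=> x y x0 xy; apply: Fni; first by rewrite divr_gt0// exprn_gt0.
  by rewrite ler_pM2r// invr_gt0 exprn_gt0.
by rewrite exprS EFinM -muleA lee_wpmul2l.
Qed.

(** This puts the upper Boyd index of every rearrangement invariant space at
    most 1, and lets the case s > alpha follow from [Linfty_embedding]. *)
Lemma dilation_norm_two_le : dilation_norm rhobar 2 <= 2%:E.
Proof.
apply: ge_ereal_sup => _ [f [mf f1] <-].
apply: (@le_trans _ _ (2%:E * norm_of rhobar f)); last by rewrite -[leRHS]mule1 lee_wpmul2l.
rewrite -(norm_of_rearr hri mf); apply: norm_of_dilate_two.
- exact: measurable_rearr.
- exact: rearr_ge0.
- by move=> x y _; exact: rearr_nonincreasing.
Qed.

End dilation_by_two.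

(** * Averages of decreasing functions *)
Section averaging.
Context {R : realType} (rhobar : (R -> \bar R) -> \bar R).
Hypothesis hri : ri_norm (leb_half_line R) rhobar.
Variables (F : measurableTypeR R -> \bar R) (n : nat) (a : R).
Hypotheses (mF : measurable_fun [set: measurableTypeR R] F) (F0 : forall x, 0 <= F x).
Hypothesis Fni : forall x y, (0 < x)%R -> (x <= y)%R -> F y <= F x.
Hypothesis a0 : (0 < a)%R.

Definition cell (k : nat) : set (measurableTypeR R) := `](k%:R * a)%R, (k.+1%:R * a)%R]%classic.
(** The value of F at the right end of a cell, so that the step function taking
    these values lies below F. *)
Definition cell_value (k : nat) : \bar R := F (k.+1%:R * a)%R.
(** The addition is that of the cyclic group: the values of the step function
    are permuted cyclically among the cells. *)
Definition rotated (j : 'I_n.+1) (x : measurableTypeR R) : \bar R :=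
  \sum_(k < n.+1) cell_value (k + j : 'I_n.+1)%R * (\1_(cell k) x)%:E.

Lemma measurable_cell k : measurable (cell k). Proof. exact: measurable_itv. Qed.

Lemma measure_cell k : @lebesgue_measure R (cell k) = a%:E.
Proof.
rewrite /cell lebesgue_measure_itv/= lte_fin ltr_pM2r// ltr_nat ltnSn.
by rewrite -EFinB -mulrBl -natr1 addrAC subrr add0r mul1r.
Qed.

Lemma in_cells (P : pred 'I_n.+1) x :
  (\big[setU/set0]_(k < n.+1 | P k) cell k) x <-> exists2 k : 'I_n.+1, P k & cell k x.
Proof.
rewrite -bigcup_seq_cond; split => [[k /= /andP[_ Pk] xk]|[k Pk xk]]; exists k => //=.
by rewrite mem_index_enum Pk.
Qed.

Lemma cell_inj k k' x : cell k x -> cell k' x -> k = k'.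
Proof.
rewrite /cell /= !in_itv/= => /andP[k1 k2] /andP[j1 j2].
have := lt_le_trans k1 j2; have := lt_le_trans j1 k2.
by rewrite !ltr_pM2r// !ltr_nat; lia.
Qed.

Lemma cell_exists x : (0 < x)%R -> exists k, cell k x.
Proof.
move=> x0; have ex : exists k, (x <= k.+1%:R * a)%R.
  exists (Num.truncn (x / a)); rewrite -ler_pdivrMr//.
  have xa0 : (0 <= x / a)%R by rewrite divr_ge0// ltW.
  by have /andP[_ /ltW] := truncn_itv xa0.
case: (ex_minnP ex) => k xk kmin; exists k; rewrite /cell /= in_itv/= xk andbT.
case: k xk kmin => [|k] xk kmin; first by rewrite mul0r.
by rewrite ltNge; apply/negP => /kmin; rewrite ltnn.
Qed.

Lemma measure_cells (P : pred 'I_n.+1) :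
  @lebesgue_measure R (\big[setU/set0]_(k < n.+1 | P k) cell k) =
  \sum_(k < n.+1 | P k) a%:E.
Proof.
rewrite measure_bigsetU_ord.
- by apply: eq_bigr => k _; exact: measure_cell.
- by move=> k; exact: measurable_cell.
- by apply/trivIsetP => i j _ _ /eqP ij; rewrite -subset0 => x [xi xj];
    apply: ij; apply: val_inj; exact: cell_inj xi xj.
Qed.

Lemma rotated_cell j (k : 'I_n.+1) x : cell k x -> rotated j x = cell_value (k + j : 'I_n.+1)%R.
Proof.
move=> xk; rewrite /rotated (bigD1 k)//= indicE mem_set// mule1.
rewrite big1 ?adde0// => i ik; rewrite indicE memNset ?mule0// => xi.
by move/eqP: ik; apply; apply: val_inj; exact: cell_inj xi xk.
Qed.

Lemma Mplus_rotated j : Mplus (rotated j).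
Proof.
split => [|x]; last by apply: sume_ge0 => k _; rewrite mule_ge0 ?F0// lee_fin.
apply: emeasurable_sum => k; apply: emeasurable_funM; first exact: measurable_cst.
by apply/measurable_EFinP; apply: measurable_indic; exact: measurable_cell.
Qed.

(** Both superlevel sets are compared with unions of cells. Rotating changes
    which cells occur but not how many, and without rotation these cells lie in
    the superlevel set of F since F is decreasing. *)
Lemma distribution_rotated j (l : R) : (0 <= l)%R ->
  distribution_function (leb_half_line R) (rotated j) l <=
  distribution_function (leb_half_line R) F l.
Proof.
move=> l0; have [mr r0] := Mplus_rotated j.
rewrite /distribution_function !leb_half_lineE.
apply: (@le_trans _ _ (@lebesgue_measure R
    (\big[setU/set0]_(k < n.+1 | l%:E < cell_value (k + j : 'I_n.+1)%R) cell k))).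
  apply: le_measure; rewrite ?inE.
  - by apply: measurableI; [exact: measurable_superlevel|exact: measurable_itv].
  - by apply: bigsetU_measurable => k _; exact: measurable_cell.
  move=> x [/= + x0]; rewrite (gee0_abs (r0 x)) => lx; apply/in_cells.
  have [[k xk]|nx] := pselect (exists k : 'I_n.+1, cell k x).
    by exists k => //; rewrite -(rotated_cell j xk).
  move: lx; rewrite /rotated big1 ?lte_fin ?ltNge ?l0// => k _.
  by rewrite indicE memNset ?mule0// => xk; apply: nx; exists k.
rewrite measure_cells (reindex_inj (addIr (- j)%R)).
under eq_bigl do rewrite subrK.
rewrite -measure_cells; apply: le_measure; rewrite ?inE.
- by apply: bigsetU_measurable => k _; exact: measurable_cell.
- by apply: measurableI; [exact: measurable_superlevel|exact: measurable_itv].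
move=> x /in_cells[k lk xk].
have /andP[kx xk1] : (k%:R * a < x <= k.+1%:R * a)%R by move: xk; rewrite /cell /= in_itv.
have x0 : (0 < x)%R by apply: le_lt_trans kx; rewrite mulr_ge0// ltW.
split; last by rewrite /= in_itv/= x0.
by rewrite /= gee0_abs// (lt_le_trans lk)// Fni.
Qed.

(** The sum of all rotations is constant on the union of the cells, equal to
    the sum of all values, while each rotation has norm at most that of F. *)
Lemma sum_value_le_norm_of :
  (\sum_(k < n.+1) cell_value k) * fundamental_function rhobar (n.+1%:R * a) <=
  n.+1%:R%:E * norm_of rhobar F.
Proof.
have v0 (k : 'I_n.+1) : 0 <= cell_value k by exact: F0.
have na0 : (0 < n.+1%:R * a)%R by rewrite mulr_gt0.
apply: (@le_trans _ _ (norm_of rhobar (fun x => \sum_(j < n.+1) rotated j x))).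
  apply: (const_le_norm_of hri) => //.
  - by apply: emeasurable_sum => j; case: (Mplus_rotated j).
  - by apply: sume_ge0.
  move=> x /andP[x0 xna]; have [k xk] := cell_exists x0.
  have kn : (k < n.+1)%N.
    move: (xk); rewrite /cell /= in_itv/= => /andP[+ _] => /lt_trans /(_ xna).
    by rewrite ltr_pM2r// ltr_nat.
  have -> : \sum_(j < n.+1) rotated j x = \sum_(j < n.+1) cell_value (Ordinal kn + j : 'I_n.+1)%R.
    by apply: eq_bigr => j _; exact: rotated_cell.
  rewrite (reindex_inj (addrI (Ordinal kn))) gee0_abs//.
  by apply: sume_ge0 => j _; exact: F0.
apply: le_trans (norm_of_sum hri Mplus_rotated) _.
apply: (@le_trans _ _ (\sum_(j < n.+1) norm_of rhobar F)).
  apply: lee_sum => j _; apply: (le_norm_of_distribution hri) => //.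
    by case: (Mplus_rotated j).
  by move=> l; exact: distribution_rotated.
by rewrite sumr_const card_ord mule_natl.
Qed.

(** On the cell of index k + 1, F is at most its value at the left end, which is
    the value attached to cell k. The first cell is lost, as F may be unbounded
    there. *)
Lemma integral_le_sum_value :
  \int[@lebesgue_measure R]_(z in `]a, (n.+1%:R * a)%R[) F z <=
  a%:E * \sum_(k < n.+1) cell_value k.
Proof.
have mJ (k : 'I_n.+1) : measurable_fun `]a, (n.+1%:R * a)%R[%classic
    (fun z : measurableTypeR R => cell_value k * (\1_(cell k.+1) z)%:E).
  apply: emeasurable_funM; first exact: measurable_cst.
  by apply/measurable_EFinP; apply: measurable_indic; exact: measurable_cell.
have J0 (k : 'I_n.+1) (z : measurableTypeR R) : 0 <= cell_value k * (\1_(cell k.+1) z)%:E.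
  by rewrite mule_ge0 ?F0// lee_fin.
apply: (@le_trans _ _ (\int[@lebesgue_measure R]_(z in `]a, (n.+1%:R * a)%R[)
    \sum_(k < n.+1) cell_value k * (\1_(cell k.+1) z)%:E)).
  apply: ge0_le_integral => //.
  - exact: measurable_funS mF.
  - by apply: emeasurable_sum => k; exact: mJ.
  move=> z /=; rewrite in_itv/= => /andP[az zna].
  have z0 := lt_trans a0 az.
  have [k zk] := cell_exists z0.
  have /andP[ka zka] : (k%:R * a < z <= k.+1%:R * a)%R by move: zk; rewrite /cell /= in_itv.
  have kn : (k < n.+1)%N.
    by move: (lt_trans ka zna); rewrite ltr_pM2r// ltr_nat.
  case: k zk ka zka kn => [|k] zk ka zka kn.
    by move: (lt_le_trans az zka); rewrite mul1r ltxx.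
  rewrite (bigD1 (Ordinal (ltnW kn)))//= indicE mem_set// mule1.
  apply: le_trans (leeDl _ _); last by apply: sume_ge0.
  by apply: Fni; [rewrite mulr_gt0|exact: ltW].
rewrite ge0_integral_sum//.
rewrite ge0_sume_distrr; last by move=> k _; exact: F0.
apply: lee_sum => k _.
rewrite ge0_integralZl//; last 2 first.
- by apply/measurable_EFinP; apply: measurable_indic; exact: measurable_cell.
- exact: F0.
rewrite muleC lee_wpmul2r ?F0// integral_indic//; last exact: measurable_cell.
apply: (@le_trans _ _ (@lebesgue_measure R (cell k.+1))).
  by apply: measureIl => //; exact: measurable_cell.
by rewrite measure_cell.
Qed.

End averaging.

Section average_bound.
Context {R : realType} (rhobar : (R -> \bar R) -> \bar R).
Hypothesis hri : ri_norm (leb_half_line R) rhobar.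

(** Cut (0, t) into n + 1 cells and combine the two preceding bounds. The
    omitted first cell shrinks to nothing as n grows, by monotone
    convergence. *)
Lemma fundamental_function_average_le (F : measurableTypeR R -> \bar R) (t : R) :
  measurable_fun [set: measurableTypeR R] F -> (forall x, 0 <= F x) ->
  (forall x y, (0 < x)%R -> (x <= y)%R -> F y <= F x) -> (0 < t)%R ->
  fundamental_function rhobar t *
    ((t^-1)%:E * \int[@lebesgue_measure R]_(z in `]0%R, t[) F z) <=
  norm_of rhobar F.
Proof.
move=> mF F0 Fni t0; set phi := fundamental_function rhobar t.
have phi0 : 0 < phi by exact: fundamental_function_gt0.
have phin : phi \is a fin_num.
  by rewrite ge0_fin_numE ?ltW// (fundamental_function_fin hri).
pose D n : set (measurableTypeR R) := `](t / n.+1%:R)%R, t[%classic.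
have mD n : measurable (D n) by exact: measurable_itv.
have ndD : nondecreasing_seq D.
  move=> m n mn; apply/subsetPset => x /=; rewrite /D /= !in_itv/= => /andP[mx ->].
  rewrite andbT; apply: le_lt_trans mx; rewrite ler_pM2l// lef_pV2 ?posrE//.
  by rewrite ler_nat ltnS.
have UD : \bigcup_n D n = `]0%R, t[%classic.
  apply/seteqP; split => x /=.
    move=> [n _]; rewrite /D /= !in_itv/= => /andP[nx ->]; rewrite andbT.
    by apply: lt_trans nx; rewrite divr_gt0.
  rewrite in_itv/= => /andP[x0 xt].
  have /ltr_add_invr[n] : (0 < x / t)%R by rewrite divr_gt0.
  rewrite add0r ltr_pdivlMr// mulrC => nx.
  by exists n => //; rewrite /D /= in_itv/= xt nx.
have step n : phi * \int[@lebesgue_measure R]_(z in D n) F z <= t%:E * norm_of rhobar F.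
  have a0 : (0 < t / n.+1%:R)%R by rewrite divr_gt0.
  have tE : (n.+1%:R * (t / n.+1%:R) = t)%R by field; rewrite nat1r.
  have := @integral_le_sum_value R F n _ mF F0 Fni a0; rewrite tE => /(lee_wpmul2l (ltW phi0)) h.
  apply: le_trans h _; rewrite muleCA [phi * _]muleC.
  have -> : t%:E * norm_of rhobar F =
      (t / n.+1%:R)%:E * (n.+1%:R%:E * norm_of rhobar F).
    by rewrite muleA -EFinM [(_ / _ * _)%R]mulrC tE.
  apply: lee_wpmul2l; first by rewrite lee_fin ltW.
  by have := @sum_value_le_norm_of R rhobar hri F n _ mF F0 Fni a0; rewrite tE.
have cv : (phi * \int[@lebesgue_measure R]_(z in D n) F z) @[n --> \oo] -->
    phi * \int[@lebesgue_measure R]_(z in `]0%R, t[) F z.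
  apply: cvgeZl => //; rewrite -UD; apply: ge0_nondecreasing_set_cvg_integral => //.
  by move=> i; exact: measurable_funS mF.
rewrite muleCA lee_pdivrMl// -(cvg_lim _ cv)//; apply: lime_le.
  by apply/cvg_ex; eexists; exact: cv.
exact: nearW.
Qed.

End average_bound.

(** * Norms of dilations and Boyd indices *)
Lemma rearr_scale_le {d} {T : measurableType d} {R : realType}
    (mu : {measure set T -> \bar R}) (f : T -> \bar R) (a t : R) :
  measurable_fun [set: T] f -> (0 < a)%R ->
  rearr mu (fun x => a%:E * f x) t <= a%:E * rearr mu f t.
Proof.
move=> mf a0; case E : (rearr mu f t) => [r| |].
- have r0 : (0 <= r)%R by rewrite -lee_fin -E rearr_ge0.
  rewrite -EFinM rearr_leE; [|exact: measurable_funeM|by rewrite mulr_ge0// ltW].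
  have : rearr mu f t <= r%:E by rewrite E.
  rewrite rearr_leE//; apply: le_trans; rewrite le_eqVlt; apply/orP; left; apply/eqP.
  congr (mu _); apply/seteqP; split => x /=;
    by rewrite EFinM abseM (gee0_abs (_ : 0 <= a%:E)) ?lee_fin  1?ltW// lte_pmul2l ?lte_fin.
- by rewrite mulry gtr0_sg// mul1e leey.
- by have := rearr_ge0 mu f t; rewrite E.
Qed.

Section dilation_norm.
Context {R : realType} (rhobar : (R -> \bar R) -> \bar R).
Hypothesis hri : ri_norm (leb_half_line R) rhobar.
Variables (sigma q : R).
Hypotheses (sigma0 : (0 < sigma)%R) (q0 : (0 <= q)%R).
Hypothesis hq : dilation_norm rhobar sigma <= q%:E.

(** The operator norm only controls functions of norm at most 1. Dividing f by
    its norm M would fail for M = 0, so f is divided by numbers slightly larger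
    than its norm. *)
Lemma norm_of_dilation (f : measurableTypeR R -> \bar R) :
  measurable_fun [set: measurableTypeR R] f -> norm_of rhobar f < +oo ->
  norm_of rhobar (dilation sigma f) <= q%:E * norm_of rhobar f.
Proof.
move=> mf fN; have f0 := norm_of_ge0 hri mf.
have mdil (g : measurableTypeR R -> \bar R) :
    measurable_fun [set: measurableTypeR R] (dilation sigma g).
  apply: measurable_dilate; exact: measurable_rearr.
have key (M : R) : (0 < M)%R -> norm_of rhobar f <= M%:E ->
    norm_of rhobar (dilation sigma f) <= (M * q)%:E.
  move=> M0 fM; pose g x := M^-1%:E * f x.
  have mg : measurable_fun [set: measurableTypeR R] g by exact: measurable_funeM.
  have g1 : norm_of rhobar g <= 1.
    have Mi0 : (0 <= M^-1)%R by rewrite invr_ge0 ltW.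
    by rewrite (norm_of_scale hri Mi0 mf) lee_pdivrMl// mule1.
  have gq : norm_of rhobar (dilation sigma g) <= q%:E.
    by apply: le_trans hq; apply: ereal_sup_ubound; exists g.
  apply: (@le_trans _ _ (norm_of rhobar (fun x => M%:E * dilation sigma g x))).
    apply: (le_norm_of hri) => //; first exact: measurable_funeM.
    have Mge0 : 0 <= M%:E by rewrite lee_fin ltW.
    move=> x x0; rewrite !gee0_abs ?mule_ge0 ?rearr_ge0//.
    have fE : f = (fun x => M%:E * g x).
      by apply/funext => y; rewrite /g muleA -EFinM divff ?gt_eqF// mul1e.
    by rewrite /dilation {1}fE; exact: rearr_scale_le.
  by rewrite (norm_of_scale hri (ltW M0) (mdil g)) EFinM lee_wpmul2l// lee_fin ltW.
apply/lee_addgt0Pr => e e0.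
have fn : norm_of rhobar f \is a fin_num by rewrite ge0_fin_numE.
pose de := (e / (q + 1))%R.
have q1 : (0 < q + 1)%R by rewrite ltr_wpDl.
have de0 : (0 < de)%R by rewrite divr_gt0.
have fine0 : (0 <= fine (norm_of rhobar f))%R by exact: fine_ge0.
apply: le_trans (key (fine (norm_of rhobar f) + de)%R _ _) _.
- by rewrite ltr_wpDl.
- by rewrite EFinD fineK// leeDl// lee_fin ltW.
- rewrite -[X in _ * X + _](fineK fn) -EFinM -EFinD lee_fin mulrDl mulrC lerD2l.
  by rewrite /de mulrAC ler_pdivrMr// ler_pM2l// lerDl.
Qed.

Context {d : measure_display} {T : measurableType d}.
Variables (mu : {measure set T -> \bar R}) (f : T -> \bar R).
Hypotheses (mf : measurable_fun [set: T] f).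
Hypothesis fN : norm_of rhobar (rearr mu f) < +oo.

(** By [rearr_dilate], the k-th power of the dilation acts on a rearrangement as
    the dilation by sigma^k. *)
Lemma norm_of_dilate_rearr k :
  norm_of rhobar (fun t => rearr mu f (t / sigma ^+ k)) <=
  (q ^+ k)%:E * norm_of rhobar (rearr mu f).
Proof.
elim: k => [|k ih].
  by rewrite expr0 mul1e; under eq_fun do rewrite divr1.
have mG j : measurable_fun [set: measurableTypeR R] (fun t => rearr mu f (t / sigma ^+ j)).
  apply: measurable_dilate; exact: measurable_rearr.
rewrite [in leRHS]exprS EFinM -muleA.
apply: le_trans (lee_wpmul2l _ ih); last by rewrite lee_fin.
have GN : norm_of rhobar (fun t => rearr mu f (t / sigma ^+ k)) < +oo.
  by apply: (le_lt_trans ih); rewrite lte_mul_pinfty ?lee_fin ?exprn_ge0.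
apply: le_trans (norm_of_dilation (mG k) GN).
apply: (le_norm_of hri) => //.
  apply: measurable_dilate; exact: measurable_rearr.
move=> x x0; rewrite /dilation rearr_dilate ?exprn_gt0 ?divr_gt0//.
by rewrite exprS invfM mulrA.
Qed.

(** The dilate of the rearrangement by sigma^k is at least its value at
    sigma^-k on the whole of (0, 1). For sigma > 1 this limits the growth at 0,
    for sigma < 1 it forces decay at infinity. *)
Lemma rearr_geometric_bound k :
  rearr mu f (sigma ^- k) * fundamental_function rhobar 1 <=
  (q ^+ k)%:E * norm_of rhobar (rearr mu f).
Proof.
apply: le_trans (norm_of_dilate_rearr k); apply: (const_le_norm_of hri) => //.
- apply: measurable_dilate; exact: measurable_rearr.
- exact: rearr_ge0.
move=> x /andP[x0 x1]; rewrite gee0_abs ?rearr_ge0//; apply: rearr_nonincreasing.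
by rewrite ler_piMl ?invr_ge0 ?exprn_ge0// ltW.
Qed.

End dilation_norm.

Section boyd.
Context {R : realType} (rhobar : (R -> \bar R) -> \bar R).

(** The real number q absorbs the degenerate values 0 and -oo of h. *)
Lemma lne_lt_ln (h : \bar R) (y : R) : (0 < y)%R -> lne h < (ln y)%:E ->
  exists q : R, [/\ (0 <= q)%R, (q < y)%R & h <= q%:E].
Proof.
move=> y0; case: h => [r| |] //= h; last by exists 0%R; split=> //; rewrite leNye.
have [r0|r0] := leP r 0%R; first by exists 0%R.
exists r; split => //; first exact: ltW.
move: h; case: ifPn => [r0'|_]; first by rewrite ltNge r0' in r0.
by rewrite lte_fin ltr_ln ?posrE.
Qed.

Lemma upper_boyd_lt (b : R) : upper_boyd rhobar < b%:E ->
  exists sigma q : R, [/\ (1 < sigma)%R, (0 <= q)%R, (q < sigma `^ b)%R &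
    dilation_norm rhobar sigma <= q%:E].
Proof.
move=> /ereal_inf_lt[_ [sigma /= s1 <-]].
have s0 : (0 < sigma)%R := lt_trans ltr01 s1.
rewrite lte_pdivrMr ?ln_gt0// -EFinM -ln_powR.
move=> /(lne_lt_ln (powR_gt0 _ s0))[q [q0 qb hq]].
by exists sigma, q.
Qed.

Lemma lower_boyd_gt (b : R) : b%:E < lower_boyd rhobar ->
  exists sigma q : R, [/\ (0 < sigma < 1)%R, (0 <= q)%R, (q < sigma `^ b)%R &
    dilation_norm rhobar sigma <= q%:E].
Proof.
move=> /ereal_sup_gt[_ [sigma /= /andP[s0 s1] <-]].
have ls : (ln sigma < 0)%R by rewrite ln_lt0// s0.
move=> h; have : lne (dilation_norm rhobar sigma) < (ln (sigma `^ b))%:E.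
  rewrite ln_powR EFinM -lte_ndivlMr//.
move=> /(lne_lt_ln (powR_gt0 _ s0))[q [q0 qb hq]].
by exists sigma, q; rewrite s0.
Qed.

End boyd.

(** * The gradient inequality for rearrangements *)
Section rearranged_gradient_inequality.
Context {d : measure_display} {R : realType} {T : metricMeasurableType d R}.
Variables (mu : {measure set T -> \bar R}) (c alpha s : R).
Hypotheses (hmu : metric_measure_space mu) (hac : almost_continuous mu c).
Hypotheses (c1 : (1 <= c)%R) (alpha0 : (0 < alpha)%R) (s0 : (0 < s)%R).
Hypothesis hlb : lower_bounded mu alpha.
Variables (f g : T -> R) (N : set T).
Hypotheses (mf : measurable_fun [set: T] f) (mg : measurable_fun [set: T] g).
Hypotheses (g0 : forall x, (0 <= g x)%R) (N0 : mu.-negligible N).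
Hypothesis fgN : forall x y, ~ N x -> ~ N y ->
  (`|f x - f y| <= mdist x y `^ s * (g x + g y))%R.

Local Notation b := (s / alpha)%R.
Local Notation K := ((3 * c) `^ b)%R.
Local Notation f' := (rearr mu (EFin \o f)).
Local Notation g' := (rearr mu (EFin \o g)).

Let c30 : (0 < 3 * c)%R.
Proof. by rewrite mulr_gt0// (lt_le_trans ltr01). Qed.

Lemma measurable_metric_ball (x : T) (r : R) : measurable (ball x r).
Proof.
rewrite (mms_borel hmu); apply: sub_sigma_algebra => /=.
rewrite openE => y /=; rewrite ballEmdist /= => xy; apply/nbhs_ballP.
exists (r - mdist x y)%R => /=; first by rewrite subr_gt0.
move=> z; rewrite !ballEmdist/= ltrBrDl; apply: le_lt_trans; exact: metric_triangle.
Qed.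

(** A ball around x of measure at least 3 t cannot be covered by a null set and
    two sets of measure t, and its radius r satisfies
    r^alpha <= mu (ball x r) <= 3 c t. *)
Lemma exists_good_point (x : T) (t : R) : (0 < t)%R ->
  exists y, [/\ ~ N y, (mdist x y `^ s <= K * t `^ b)%R,
    (`|f y|)%:E <= f' t & (g y)%:E <= g' t].
Proof.
move=> t0; have t30 : (0 < 3 * t)%R by lra.
have [r r0 /andP[tB Bct]] := hac x t30.
have rb : (r `^ s <= K * t `^ b)%R.
  rewrite -powRM ?(ltW c30) ?(ltW t0)//.
  have -> : (r `^ s = (r `^ alpha) `^ b)%R by rewrite -powRrM mulrCA divff ?mulr1 ?gt_eqF.
  apply: ge0_ler_powR; rewrite ?nnegrE ?powR_ge0//.
  - by rewrite divr_ge0// ltW.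
  - by rewrite mulr_ge0// ltW.
  by rewrite -lee_fin (le_trans (hlb x r0))// (le_trans Bct)// lee_fin; lra.
have mEf : measurable_fun [set: T] (EFin \o f) by exact/measurable_EFinP.
have mEg : measurable_fun [set: T] (EFin \o g) by exact/measurable_EFinP.
apply: contrapT => H.
have [N' [mN' N'0 NN']] := N0.
pose A := [set y | f' t < `|(EFin \o f) y|].
pose A' := [set y | g' t < `|(EFin \o g) y|].
have mA : measurable A by exact: measurable_superlevel.
have mA' : measurable A' by exact: measurable_superlevel.
have BU : ball x r `<=` N' `|` (A `|` A').
  move=> y xy; apply: contrapT => /not_orP[yN /not_orP[yA yA']]; apply: H; exists y; split.
  - by move=> /NN'.
  - apply: le_trans rb; apply: ge0_ler_powR; rewrite ?nnegrE ?mdist_ge0 ?ltW//.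
    by move: xy; rewrite ballEmdist.
  - by rewrite leNgt; apply/negP.
  - by rewrite leNgt; apply/negP => h; apply: yA'; rewrite /A' /= ger0_norm.
have : mu (ball x r) <= t%:E + t%:E.
  apply: (@le_trans _ _ (mu (N' `|` (A `|` A')))).
    apply: le_measure; rewrite ?inE//; first exact: measurable_metric_ball.
    by apply: measurableU => //; exact: measurableU.
  apply: (le_trans (measureU2 mu mN' (measurableU _ _ mA mA'))).
  rewrite -[leRHS]add0e; apply: leeD; first by rewrite -N'0.
  apply: (le_trans (measureU2 mu mA mA')).
  by apply: leeD; apply: measure_gt_rearr => //; exact: ltW.
move=> /(le_trans tB); rewrite -EFinD lee_fin; lra.
Qed.

(** The good point y for x gives |f x| <= f' t + K t^b (g x + g' t). Where
    g x <= g' z, which excludes a set of measure at most z, the bracket is at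
    most 2 g' z, because g' decreases. *)
Lemma rearr_gradient_le (z t : R) : (0 < z)%R -> (z <= t)%R ->
  f' z <= f' t + (2 * K * t `^ b)%:E * g' z.
Proof.
move=> z0 zt; have t0 := lt_le_trans z0 zt.
have mEf : measurable_fun [set: T] (EFin \o f) by exact/measurable_EFinP.
have mEg : measurable_fun [set: T] (EFin \o g) by exact/measurable_EFinP.
have b0 : (0 < K * t `^ b)%R by rewrite mulr_gt0 ?powR_gt0.
have b2 : (0 < 2 * K * t `^ b)%R by rewrite -mulrA mulr_gt0.
have f't0 : 0 <= f' t by exact: rearr_ge0.
have g'z0 : 0 <= g' z by exact: rearr_ge0.
have g'tz : g' t <= g' z by exact: rearr_nonincreasing.
case Ef : (f' t) f't0 => [u| |] //; last first.
  have : 0 <= (2 * K * t `^ b)%:E * g' z by rewrite mule_ge0// lee_fin ltW.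
  by move=> /(lt_le_trans (ltNyr 0%R)) h; rewrite addye ?leey// gt_eqF.
case Eg : (g' z) g'z0 => [v| |] //; last by rewrite gt0_muley ?lte_fin// addey ?leey.
rewrite !lee_fin => v0 u0; rewrite -EFinM -EFinD.
have uv0 : (0 <= u + 2 * K * t `^ b * v)%R by rewrite addr_ge0// mulr_ge0// ltW.
rewrite rearr_leE//.
have [N' [mN' N'0 NN']] := N0.
pose A' := [set y | g' z < `|(EFin \o g) y|].
have mA' : measurable A' by exact: measurable_superlevel.
apply: (@le_trans _ _ (mu (N' `|` A'))).
  apply: le_measure; rewrite ?inE//; [exact: measurable_superlevel|exact: measurableU|].
  move=> x /=; rewrite lte_fin => fx; apply: contrapT => /not_orP[xN xA'].
  have [y [yN dK fy gy]] := exists_good_point x t0.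
  have gx : (g x <= v)%R.
    rewrite -lee_fin -Eg leNgt; apply/negP => h; apply: xA'.
    by rewrite /A' /= ger0_norm.
  have gyv : (g y <= v)%R by rewrite -lee_fin -Eg (le_trans gy).
  have fyu : (`|f y| <= u)%R by rewrite -lee_fin -Ef.
  have xNN : ~ N x by move=> /NN'.
  have h1 := fgN xNN yN.
  have h2 : (mdist x y `^ s * (g x + g y) <= K * t `^ b * (2 * v))%R.
    by apply: ler_pM => //; [exact: powR_ge0|exact: addr_ge0|lra].
  have h3 : (`|f x| <= `|f y| + `|f x - f y|)%R.
    by rewrite -{1}(subrK (f y) (f x)) addrC ler_normD.
  lra.
apply: (le_trans (measureU2 mu mN' mA')).
rewrite -[leRHS]add0e; apply: leeD; first by rewrite -N'0.
by apply: measure_gt_rearr => //; exact: ltW.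
Qed.

End rearranged_gradient_inequality.

(** * Geometric series and sup norms *)
Section geometric_series.
Context {R : realType}.
Implicit Types (a r e : R) (y : \bar R).

Lemma geometric_sum_le r n : (0 <= r < 1)%R ->
  (\sum_(k < n) r ^+ k <= (1 - r)^-1)%R.
Proof.
move=> /andP[r0 r1]; have r1' : (0 < 1 - r)%R by rewrite subr_gt0.
rewrite -[leRHS]mul1r ler_pdivlMr// mulrC.
have -> : ((1 - r) * \sum_(k < n) r ^+ k = 1 - r ^+ n)%R.
  by rewrite -[RHS]opprB subrX1 -mulNr opprB.
by rewrite gerBl exprn_ge0.
Qed.

Lemma geometric_series_le a r y : (0 <= a)%R -> (0 <= r < 1)%R -> 0 <= y ->
  \sum_(0 <= k <oo) (a * r ^+ k)%:E * y <= (a / (1 - r))%:E * y.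
Proof.
move=> a0 r01 y0; have /andP[r0 _] := r01.
have c0 k : (0 <= a * r ^+ k)%R by rewrite mulr_ge0// exprn_ge0.
apply: lime_le.
  by apply: is_cvg_nneseries => k _ _; rewrite mule_ge0// lee_fin.
apply: nearW => n; rewrite -ge0_sume_distrl; last by move=> k _; rewrite lee_fin.
apply: lee_wpmul2r => //; rewrite sumEFin lee_fin -mulr_sumr ler_wpM2l// big_mkord.
exact: geometric_sum_le.
Qed.

Lemma expr_lt_exists r e : (0 <= r < 1)%R -> (0 < e)%R -> exists n, (r ^+ n < e)%R.
Proof.
move=> /andP[r0 r1] e0.
have /cvgrPdist_lt/(_ e e0)[n _ /(_ n (leqnn n))] : (GRing.exp r : R^nat) @ \oo --> (0 : R)%R.
  by apply: cvg_expr; rewrite ger0_norm.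
by rewrite /= sub0r normrN ger0_norm ?exprn_ge0// => h; exists n.
Qed.

Lemma powR_exprVn (x b : R) n : (0 < x)%R -> ((x ^- n) `^ b = (x `^ b) ^- n)%R.
Proof.
move=> x0; elim: n => [|n ih]; first by rewrite !expr0 !invr1 powR1.
rewrite !exprS !invfM powRM ?invr_ge0 ?exprn_ge0 ?(ltW x0)// ih; congr (_ * _)%R.
have xb : (x `^ b != 0)%R by rewrite gt_eqF// powR_gt0.
apply: (mulfI xb); rewrite divff// -powRM ?invr_ge0 ?(ltW x0)// divff ?powR1//.
by rewrite gt_eqF.
Qed.

End geometric_series.

Section norms_of_real_functions.
Context {d : measure_display} {T : measurableType d} {R : realType}.
Variable mu : {measure set T -> \bar R}.
Implicit Types f : T -> R.

(** If |g + h| > A + B, where A is the L1 norm of g and B the sup norm of h,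
    then |g| > A almost everywhere, which by the Chebyshev inequality happens on
    a set of measure at most 1. *)
Lemma rearr1_le_L1_plus_Linfty f :
  rearr mu (EFin \o f) 1 <= norm_L1_plus_Linfty mu f.
Proof.
apply: le_ereal_inf_tmp => _ [g [h [mg mh -> ->]]].
have mEg : measurable_fun [set: T] (EFin \o g) by exact/measurable_EFinP.
have mEh : measurable_fun [set: T] (EFin \o h) by exact/measurable_EFinP.
have : 0 <= 'N[mu]_1[EFin \o g] by exact: Lnorm_ge0.
case E1 : 'N[mu]_1[EFin \o g] => [A| |] // A0; last first.
  by rewrite addye ?leey// gt_eqF// (lt_le_trans (ltNyr 0%R))// Lnorm_ge0.
have : 0 <= 'N[mu]_+oo[EFin \o h] by exact: Lnorm_ge0.
case E2 : 'N[mu]_+oo[EFin \o h] => [B| |] // B0; last by rewrite addey ?leey.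
rewrite !lee_fin in A0 B0; rewrite -EFinD rearr_leE ?addr_ge0//; last first.
  by apply/measurable_EFinP; exact: measurable_funD.
apply: (@le_trans _ _ (distribution_function mu (EFin \o g) A)); last first.
  (* The Chebyshev inequality needs a positive level, so the level A, which
     may be 0, is approached from above. *)
  apply: distribution_function_right_continuous => // l Al.
  have l0 : (0 < l)%R by exact: le_lt_trans Al.
  have := @le_integral_comp_abse _ _ _ mu setT measurableT (EFin \o g) l id
    (@measurable_id _ _ _) (fun r => id) (fun x y _ _ => id) mEg l0.
  rewrite -Lnorm1 E1 setTI => h1.
  have h2 : l%:E * distribution_function mu (EFin \o g) l <= l%:E * 1.
    rewrite mule1; apply: (@le_trans _ _ A%:E); last by rewrite lee_fin ltW.
    apply: le_trans h1; rewrite lee_wpmul2l ?lee_fin ?(ltW l0)//.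
    apply: le_measure; rewrite ?inE; first exact: measurable_superlevel.
      rewrite -[X in measurable X]setTI.
      by apply: emeasurable_fun_c_infty => //; exact: measurableT_comp.
    by move=> x /= /ltW.
  by rewrite lee_pmul2l// in h2.
have [muT|muT] := ltP 0 (mu [set: T]); last first.
  rewrite (@le_trans _ _ 0)// (le_trans _ muT)// le_measure ?inE//.
  by apply: measurable_superlevel; apply/measurable_EFinP; exact: measurable_funD.
have /ess_supP[N [mN N0 hN]] : ess_sup mu (abse \o (EFin \o h)) <= B%:E.
  by move: E2; rewrite unlock muT => ->.
have mS : measurable [set x | A%:E < `|(EFin \o g) x|] by exact: measurable_superlevel.
apply: (@le_trans _ _ (mu (N `|` [set x | A%:E < `|(EFin \o g) x|]))).
  apply: le_measure; rewrite ?inE.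
  - by apply: measurable_superlevel; apply/measurable_EFinP; exact: measurable_funD.
  - exact: measurableU.
  move=> x /=; rewrite lte_fin => ABx; have [Nx|Nx] := pselect (N x); [by left|right].
  have hB : (`|h x| <= B)%R.
    by rewrite -lee_fin; apply: contrapT => H; apply: Nx; apply: hN.
  rewrite lte_fin; have := ler_normD (g x) (h x); lra.
apply: (le_trans (measureU2 mu mN mS)).
by rewrite -[leRHS]add0e; apply: leeD => //; rewrite -N0.
Qed.

(** The set where |f| > M has measure at most r^n for every n. *)
Lemma Lnorm_infty_le_rearr f (r M : R) : measurable_fun [set: T] f ->
  (0 <= r < 1)%R -> (0 <= M)%R ->
  (forall n, rearr mu (EFin \o f) (r ^+ n) <= M%:E) -> 'N[mu]_+oo[EFin \o f] <= M%:E.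
Proof.
move=> mf r01 M0 H.
have mEf : measurable_fun [set: T] (EFin \o f) by exact/measurable_EFinP.
rewrite unlock; case: ifP => _; last by rewrite lee_fin.
apply/ess_supP.
exists [set x | M%:E < `|(EFin \o f) x|]; split.
- exact: measurable_superlevel.
- apply/eqP; rewrite eq_le measure_ge0 andbT.
  apply/lee_addgt0Pr => e e0; rewrite add0e.
  have [n rn] := expr_lt_exists r01 e0.
  apply: (@le_trans _ _ (r ^+ n)%:E); last by rewrite lee_fin ltW.
  by have := H n; rewrite rearr_leE.
- by move=> x /=; rewrite ltNge => /negP.
Qed.

End norms_of_real_functions.

(** * Consequences on the half-line *)
Section consequences.
Context {d : measure_display} {T : measurableType d} {R : realType}.
Context (mu : {measure set T -> \bar R}) (rhobar : (R -> \bar R) -> \bar R).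
Hypothesis hri : ri_norm (leb_half_line R) rhobar.
Variables (f g : T -> \bar R).
Hypotheses (mf : measurable_fun [set: T] f) (mg : measurable_fun [set: T] g).
Hypothesis fN : norm_of rhobar (rearr mu f) < +oo.
Hypothesis gN : norm_of rhobar (rearr mu g) < +oo.
Variables K b : R.
Hypotheses (K0 : (0 < K)%R) (b0 : (0 < b)%R).
Hypothesis fg : forall z t : R, (0 < z)%R -> (z <= t)%R ->
  rearr mu f z <= rearr mu f t + (K * t `^ b)%:E * rearr mu g z.

Local Notation f' := (rearr mu f).
Local Notation g' := (rearr mu g).
Local Notation Nf := (norm_of rhobar f').
Local Notation Ng := (norm_of rhobar g').
Local Notation phi1 := (fine (fundamental_function rhobar 1)).

Let f'0 t : 0 <= f' t. Proof. exact: rearr_ge0. Qed.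
Let g'0 t : 0 <= g' t. Proof. exact: rearr_ge0. Qed.

Lemma rearr_fundamental_le t : (0 < t)%R ->
  f' t * fundamental_function rhobar t <= Nf.
Proof.
move=> t0; apply: (const_le_norm_of hri) => //; first exact: measurable_rearr.
by move=> x /andP[_ /ltW xt]; rewrite gee0_abs//; exact: rearr_nonincreasing.
Qed.

Lemma rearr_fin_num t : (0 < t)%R -> f' t \is a fin_num.
Proof.
move=> t0; rewrite ge0_fin_numE// ltey; apply/negP => /eqP E.
have := rearr_fundamental_le t0; rewrite E.
rewrite gt0_mulye; last exact: (fundamental_function_gt0 hri).
by rewrite leye_eq => /eqP h; move: fN; rewrite h ltxx.
Qed.

Lemma fundamental_function1E : fundamental_function rhobar 1 = phi1%:E /\ (0 < phi1)%R.
Proof.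
have p0 := fundamental_function_gt0 hri ltr01.
have pn : fundamental_function rhobar 1 \is a fin_num.
  by rewrite ge0_fin_numE ?ltW// (fundamental_function_fin hri).
by rewrite fineK// fine_gt0// p0 (fundamental_function_fin hri).
Qed.

(** Integrating the inequality over z in (0, t) bounds the oscillation of the
    rearrangement by the integral of g', to which
    [fundamental_function_average_le] applies. *)
Lemma oscillation_le : b = 1%R ->
  ereal_sup [set fundamental_function rhobar t *
    ((rearr_avg mu f t - f' t) * (t^-1)%:E) | t in [set t : R | (0 < t)%R]]
  <= K%:E * Ng.
Proof.
move=> b1; apply: ge_ereal_sup => _ [t /= t0 <-].
pose I := \int[@lebesgue_measure R]_(z in `]0%R, t[) g' z.
have I0 : 0 <= I by exact: integral_ge0.
have phi0 := ltW (fundamental_function_gt0 hri t0).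
have avgI : rearr_avg mu f t - f' t <= K%:E * I.
  have [u fu] : exists u, f' t = u%:E.
    by exists (fine (f' t)); rewrite fineK// rearr_fin_num.
  have u0 : (0 <= u)%R by rewrite -lee_fin -fu.
  rewrite fu leeBlDr// /rearr_avg lee_pdivrMl//.
  apply: (@le_trans _ _ (\int[@lebesgue_measure R]_(z in `]0%R, t[)
      (u%:E + (K * t)%:E * g' z))).
    apply: ge0_le_integral => //.
    - exact: measurable_funS (measurable_rearr _ _).
    - apply: emeasurable_funD; first exact: measurable_cst.
      by apply: measurable_funeM; exact: measurable_funS (measurable_rearr _ _).
    move=> z /=; rewrite in_itv/= => /andP[z0 /ltW zt].
    by have := fg z0 zt; rewrite fu b1 powRr1// ltW.
  have Kt0 : (0 <= K * t)%R by rewrite mulr_ge0// ltW.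
  rewrite ge0_integralD//; last 2 first.
  - by move=> z _; rewrite mule_ge0// lee_fin.
  - by apply: measurable_funeM; exact: measurable_funS (measurable_rearr _ _).
  rewrite integral_cst//= lebesgue_measure_itv/= lte_fin t0 -EFinB subr0.
  rewrite ge0_integralZl_EFin//; last exact: measurable_funS (measurable_rearr _ _).
  have KI0 : 0 <= K%:E * I by rewrite mule_ge0// lee_fin ltW.
  rewrite -/I [leRHS]ge0_muleDr ?lee_fin//.
  have -> : (K * t)%:E * I = t%:E * (K%:E * I) by rewrite muleA -EFinM mulrC.
  by rewrite addeC [u%:E * _]muleC.
apply: (@le_trans _ _ (K%:E * (fundamental_function rhobar t * ((t^-1)%:E * I)))).
  rewrite [leRHS]muleCA; apply: lee_wpmul2l => //.
  rewrite [leLHS]muleC [leRHS]muleCA; apply: lee_wpmul2l => //.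
  by rewrite lee_fin invr_ge0 ltW.
rewrite lee_wpmul2l ?lee_fin 1?(ltW K0)//.
apply: (fundamental_function_average_le hri) => //; first exact: measurable_rearr.
by move=> x y _; exact: rearr_nonincreasing.
Qed.

Section upper.
Variables (sigma q : R).
Hypotheses (s1 : (1 < sigma)%R) (q0 : (0 <= q)%R) (qs : (q < sigma `^ b)%R).
Hypothesis hq : dilation_norm rhobar sigma <= q%:E.

Let s0 : (0 < sigma)%R. Proof. exact: lt_trans ltr01 s1. Qed.
Let sb0 : (0 < sigma `^ b)%R. Proof. exact: powR_gt0. Qed.
Local Notation r := (q / sigma `^ b)%R.
Let r01 : (0 <= r < 1)%R.
Proof. by rewrite divr_ge0 ?(ltW sb0)//= ltr_pdivrMr// mul1r. Qed.

(** Moving from sigma^-n to sigma^-(n+1) costs at most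
    K sigma^(-b n) g' (sigma^-(n+1)), and [rearr_geometric_bound] controls the
    last factor by q^(n+1). *)
Lemma rearr_telescope n :
  f' (sigma ^- n) <= f' 1 + (K * q / phi1 * \sum_(k < n) r ^+ k)%:E * Ng.
Proof.
have [phiE phi0] := fundamental_function1E.
have Ng0 : 0 <= Ng by apply: (norm_of_ge0 hri); exact: measurable_rearr.
have c0 : (0 <= K * q / phi1)%R by rewrite divr_ge0 ?mulr_ge0// ltW.
have r0 : (0 <= r)%R by case/andP: r01.
elim: n => [|n ih]; first by rewrite expr0 invr1 big_ord0 mulr0 mul0e adde0.
have z0 : (0 < sigma ^- n.+1)%R by rewrite invr_gt0 exprn_gt0.
have zt : (sigma ^- n.+1 <= sigma ^- n)%R.
  by rewrite lef_pV2 ?posrE ?exprn_gt0// ler_eXn2l// ltnW.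
apply: le_trans (fg z0 zt) _.
apply: le_trans (leeD ih (lexx _)) _; rewrite -addeA leeD2l//.
rewrite big_ord_recr/= mulrDr EFinD ge0_muleDl ?lee_fin; last 2 first.
- by rewrite mulr_ge0// sumr_ge0// => k _; exact: exprn_ge0.
- by rewrite mulr_ge0// exprn_ge0.
rewrite leeD2l//.
have gq : g' (sigma ^- n.+1) <= (q ^+ n.+1 / phi1)%:E * Ng.
  have := rearr_geometric_bound hri s0 q0 hq mg gN n.+1.
  rewrite phiE -lee_pdivlMr// => /le_trans; apply.
  by rewrite EFinM muleAC.
apply: le_trans (lee_wpmul2l _ gq) _; first by rewrite lee_fin mulr_ge0 ?powR_ge0// ltW.
rewrite muleA -EFinM powR_exprVn// expr_div_n exprS lee_wpmul2r// lee_fin.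
rewrite le_eqVlt; apply/orP; left; apply/eqP; field.
by rewrite !gt_eqF// exprn_gt0.
Qed.

Lemma rearr_bounded n :
  f' (sigma^-1 ^+ n) <= f' 1 + (K * q / phi1 / (1 - r))%:E * Ng.
Proof.
have [phiE phi0] := fundamental_function1E.
have Ng0 : 0 <= Ng by apply: (norm_of_ge0 hri); exact: measurable_rearr.
rewrite exprVn; apply: le_trans (rearr_telescope n) _; rewrite leeD2l// lee_wpmul2r//.
rewrite lee_fin ler_wpM2l//; last exact: geometric_sum_le.
by rewrite divr_ge0 ?mulr_ge0// ltW.
Qed.

End upper.

Section lower.
Variables (sigma q : R).
Hypotheses (s01 : (0 < sigma < 1)%R) (q0 : (0 <= q)%R) (qs : (q < sigma `^ b)%R).
Hypothesis hq : dilation_norm rhobar sigma <= q%:E.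

Let s0 : (0 < sigma)%R. Proof. by case/andP: s01. Qed.
Let sb0 : (0 < sigma `^ b)%R. Proof. exact: powR_gt0. Qed.
Local Notation r := (q / sigma `^ b)%R.
Let r01 : (0 <= r < 1)%R.
Proof. by rewrite divr_ge0 ?(ltW sb0)//= ltr_pdivrMr// mul1r. Qed.
Let q01 : (0 <= q < 1)%R.
Proof.
rewrite q0/= (lt_le_trans qs)//; have /andP[_ s1] := s01.
apply: (@le_trans _ _ (1 `^ b)%R); last by rewrite powR1.
by apply: ge0_ler_powR; rewrite ?nnegrE ?ltW.
Qed.
Local Notation a := (K / sigma `^ b)%R.
Let a0 : (0 <= a)%R. Proof. by rewrite divr_ge0// ltW. Qed.
Definition weighted_rearr t := (t `^ (- b))%:E * f' t.
Local Notation F := weighted_rearr.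
Let F0 t : 0 <= F t. Proof. by rewrite mule_ge0// lee_fin powR_ge0. Qed.

Lemma measurable_weighted : measurable_fun [set: measurableTypeR R] F.
Proof.
apply: emeasurable_funM; last exact: measurable_rearr.
by apply/measurable_EFinP; exact: measurable_powR.
Qed.

(** Being decreasing, the weighted rearrangement is accessible to
    [norm_of_dilate_two_iter]. *)
Lemma weighted_nonincreasing x y : (0 < x)%R -> (x <= y)%R -> F y <= F x.
Proof.
move=> x0 xy; have y0 := lt_le_trans x0 xy.
apply: lee_pmul => //; rewrite ?lee_fin ?powR_ge0//; last exact: rearr_nonincreasing.
by rewrite !powRN lef_pV2 ?posrE ?powR_gt0//; apply: ge0_ler_powR; rewrite ?nnegrE//; exact: ltW.
Qed.

(** The inequality is applied between t / sigma^k and t / sigma^(k+1). The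
    weight t^-b turns the factors (t / sigma^(k+1))^b into constants. *)
Lemma weighted_telescope t n : (0 < t)%R ->
  F t <= (t `^ (- b))%:E * f' (t / sigma ^+ n) +
    \sum_(0 <= k < n) (a * (sigma `^ b)^-1 ^+ k)%:E * g' (t / sigma ^+ k).
Proof.
move=> t0; elim: n => [|n ih]; first by rewrite expr0 divr1 big_nil adde0.
apply: (le_trans ih); rewrite big_nat_recr//= [X in _ <= _ + X]addeC addeA leeD2r//.
have z0 : (0 < t / sigma ^+ n)%R by rewrite divr_gt0// exprn_gt0.
have zt : (t / sigma ^+ n <= t / sigma ^+ n.+1)%R.
  rewrite ler_pM2l// lef_pV2 ?posrE ?exprn_gt0// exprS ler_piMl ?exprn_ge0 ?ltW//.
  by case/andP: s01.
apply: le_trans (lee_wpmul2l _ (fg z0 zt)) _; first by rewrite lee_fin powR_ge0.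
rewrite ge0_muleDr ?mule_ge0// ?lee_fin; last by rewrite mulr_ge0 ?powR_ge0// ltW.
rewrite leeD2l// muleA -EFinM lee_wpmul2r// lee_fin.
rewrite powRM ?(ltW t0) ?invr_ge0 ?exprn_ge0 ?(ltW s0)// powR_exprVn// powRN exprVn exprS.
have tb : (0 < t `^ b)%R by exact: powR_gt0.
rewrite le_eqVlt; apply/orP; left; apply/eqP; field.
by rewrite !gt_eqF// exprn_gt0.
Qed.

(** By [rearr_geometric_bound] for f itself, f' tends to 0 along sigma^-m, since
    q < sigma^b <= 1. *)
Lemma rearr_vanishes t e : (0 < t)%R -> (0 < e)%R -> exists n, f' (t / sigma ^+ n) <= e%:E.
Proof.
move=> t0 e0; have [phiE phi0] := fundamental_function1E.
have s01' : (0 <= sigma < 1)%R by case/andP: s01 => /ltW -> ->.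
have [n0 /ltW n0t] := expr_lt_exists s01' t0.
have Nf0 : 0 <= Nf by apply: (norm_of_ge0 hri); exact: measurable_rearr.
have NfE : Nf = (fine Nf)%:E by rewrite fineK// ge0_fin_numE.
have fNf0 : (0 <= fine Nf)%R by exact: fine_ge0.
have fNf1 : (0 < fine Nf + 1)%R by rewrite ltr_wpDl.
have e0' : (0 < e * phi1 / (fine Nf + 1))%R by rewrite divr_gt0// mulr_gt0.
have [m /ltW] := expr_lt_exists q01 e0'; rewrite ler_pdivlMr// => qm.
exists (m + n0)%N.
apply: (@le_trans _ _ (f' (sigma ^- m))).
  apply: rearr_nonincreasing; rewrite exprD invfM mulrCA ler_pMr ?invr_gt0 ?exprn_gt0//.
  by rewrite ler_pdivlMr ?exprn_gt0// mul1r.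
have := rearr_geometric_bound hri s0 q0 hq mf fN m.
rewrite phiE -lee_pdivlMr// => /le_trans; apply.
rewrite NfE -!EFinM lee_fin ler_pdivrMr//; apply: le_trans qm.
by rewrite ler_wpM2l ?exprn_ge0// lerDl.
Qed.

Lemma weighted_le_series t : (0 < t)%R ->
  F t <= \sum_(0 <= k <oo) (a * (sigma `^ b)^-1 ^+ k)%:E * g' (t / sigma ^+ k).
Proof.
move=> t0; apply/lee_addgt0Pr => e e0.
have tb0 : (0 < t `^ (- b))%R by exact: powR_gt0.
have e0' : (0 < e / t `^ (- b))%R by rewrite divr_gt0.
have [n fn] := rearr_vanishes t0 e0'.
apply: le_trans (weighted_telescope n t0) _; rewrite addeC; apply: leeD.
  apply: nneseries_lim_ge => k _; rewrite mule_ge0// lee_fin mulr_ge0// exprn_ge0//.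
  by rewrite invr_ge0 ltW.
apply: le_trans (lee_wpmul2l _ fn) _; first by rewrite lee_fin ltW.
by rewrite -EFinM lee_fin mulrC divfK// gt_eqF.
Qed.

(** The k-th term is sigma^(-b k) times a dilate of norm at most q^k. *)
Lemma norm_of_weighted : norm_of rhobar F <= (a / (1 - r))%:E * Ng.
Proof.
have Ng0 : 0 <= Ng by apply: (norm_of_ge0 hri); exact: measurable_rearr.
have sbi0 k : (0 <= a * (sigma `^ b)^-1 ^+ k)%R.
  by rewrite mulr_ge0// exprn_ge0// invr_ge0 ltW.
pose H k (t : measurableTypeR R) := (a * (sigma `^ b)^-1 ^+ k)%:E * g' (t / sigma ^+ k).
have mg' k : measurable_fun [set: measurableTypeR R] (fun t => g' (t / sigma ^+ k)).
  apply: measurable_dilate; exact: measurable_rearr.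
have MH k : Mplus (H k).
  split => [|x]; last by rewrite mule_ge0// lee_fin.
  exact: measurable_funeM.
apply: le_trans (norm_of_le_series hri measurable_weighted MH F0 weighted_le_series) _.
apply: le_trans (geometric_series_le a0 r01 Ng0).
apply: lee_nneseries => [k _ _|k _].
  by apply: (norm_of_ge0 hri); case: (MH k).
rewrite (norm_of_scale hri)//.
apply: le_trans (lee_wpmul2l _ (norm_of_dilate_rearr hri s0 q0 hq mg gN k)) _.
  by rewrite lee_fin.
rewrite muleA -EFinM lee_wpmul2r// lee_fin expr_div_n exprVn.
by rewrite -!mulrA [(_^-1 * q ^+ k)%R]mulrC.
Qed.

(** On the dyadic interval [t 2^-(j+1), t 2^-j[, of length t 2^-(j+1), the
    rearrangement is at most its value at the left end. *)
Lemma integral_rearr_le t : (0 < t)%R ->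
  \int[@lebesgue_measure R]_(z in `]0%R, t[) f' z <=
  \sum_(0 <= j <oo) (t / 2 ^+ j.+1)%:E * f' (t / 2 ^+ j.+1).
Proof.
move=> t0; have p2 k : (0 < 2 ^+ k :> R)%R by rewrite exprn_gt0.
pose D j : set (measurableTypeR R) := `[(t / 2 ^+ j.+1)%R, (t / 2 ^+ j)%R[%classic.
have mD j : measurable (D j) by exact: measurable_itv.
have UD : `]0%R, t[%classic = \bigcup_j D j.
  apply/seteqP; split => x /=; last first.
    move=> [j _]; rewrite /D /= !in_itv/= => /andP[jx xj]; apply/andP; split.
      by apply: lt_le_trans jx; rewrite divr_gt0.
    by apply: lt_le_trans xj _; rewrite ler_pdivrMr//; apply: ler_peMr; [exact: ltW|by rewrite exprn_ege1// ler1n].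
  rewrite in_itv/= => /andP[x0 xt].
  have ex : exists j, (t / 2 ^+ j.+1 <= x)%R.
    have h01 : (0 <= (2^-1 : R) < 1)%R by rewrite invr_ge0 ler0n/= invf_lt1// ltr1n.
    have [j jx] := @expr_lt_exists R (2^-1)%R (x / t)%R h01 (divr_gt0 x0 t0).
    exists j; rewrite ler_pdivrMr// exprS; move: jx; rewrite exprVn ltr_pdivlMr//.
    rewrite mulrC ltr_pdivrMr// => /ltW h; apply: le_trans h _.
    by rewrite ler_pM2l//; apply: ler_peMl; [exact: ltW|rewrite ler1n].
  case: (ex_minnP ex) => j jx jmin; exists j => //; rewrite /D /= in_itv/= jx/=.
  case: j jx jmin => [|j] jx jmin; first by rewrite expr0 divr1.
  by rewrite ltNge; apply/negP => /jmin; rewrite ltnn.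
rewrite UD ge0_integral_bigcup//; last 2 first.
- exact: measurable_funS (measurable_rearr _ _).
- have ltD i j : (i < j)%N -> D i `&` D j = set0.
    move=> ij; rewrite -subset0 => x []; rewrite /D /= !in_itv/= => /andP[ix _] /andP[_ jx].
    have := le_lt_trans ix jx; rewrite ltr_pM2l// ltf_pV2 ?posrE// ltr_eXn2l ?ltr1n//.
    by rewrite ltnS leqNgt ij.
  apply/trivIsetP => i j _ _; rewrite neq_ltn => /orP[|/ltD]; first exact: ltD.
  by rewrite setIC.
apply: lee_nneseries => [j _ _|j _]; first exact: integral_ge0.
apply: (@le_trans _ _ (\int[@lebesgue_measure R]_(z in D j) f' (t / 2 ^+ j.+1))).
  apply: ge0_le_integral => //.
  - exact: measurable_funS (measurable_rearr _ _).
  - by move=> z; rewrite /D /= in_itv/= => /andP[jz _]; exact: rearr_nonincreasing.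
rewrite integral_cst// [leLHS]muleC; apply: lee_wpmul2r; first exact: f'0.
rewrite /D/= lebesgue_measure_itv/= lte_fin.
case: ifPn => _; last by rewrite lee_fin divr_ge0// ltW.
rewrite -EFinB lee_fin le_eqVlt; apply/orP; left; apply/eqP.
by rewrite exprS; field; rewrite gt_eqF.
Qed.

Local Notation B := ((2^-1 : R) `^ b)%R.
Let B01 : (0 <= B < 1)%R.
Proof.
rewrite powR_ge0/=; apply: (@lt_le_trans _ _ (1 `^ b)%R); last by rewrite powR1.
apply: gt0_ltr_powR; rewrite ?nnegrE//.
by rewrite invf_lt1// ltr1n.
Qed.

(** The coefficients come from f' u = u^b F u at u = t 2^-(j+1), where F is the
    weighted rearrangement. *)
Lemma weighted_average_le t : (0 < t)%R ->
  (t `^ (- b))%:E * rearr_avg mu f t <=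
  \sum_(0 <= j <oo) (2 ^- j.+1 * B ^+ j.+1)%:E * F (t / 2 ^+ j.+1).
Proof.
move=> t0; have tb0 : (0 < t `^ b)%R by exact: powR_gt0.
have B0 : (0 <= B)%R by case/andP: B01.
rewrite /rearr_avg muleA -EFinM.
have c0 : (0 <= t `^ (- b) * t^-1)%R by rewrite mulr_ge0 ?powR_ge0// invr_ge0 ltW.
apply: le_trans (lee_wpmul2l _ (integral_rearr_le t0)) _; first by rewrite lee_fin.
have p2 k : (0 < 2 ^+ k :> R)%R by rewrite exprn_gt0.
rewrite -nneseriesZl; last by move=> j _; rewrite mule_ge0// lee_fin divr_ge0// ltW.
apply: lee_nneseries => [j _ _|j _].
  by rewrite !mule_ge0// lee_fin// divr_ge0// ltW.
rewrite /weighted_rearr !muleA -!EFinM lee_wpmul2r// lee_fin.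
have -> : (B ^+ j.+1 = (2 ^+ j.+1)^-1 `^ b)%R.
  rewrite powR_exprVn// -exprVn; congr (_ ^+ _)%R.
  by have := powR_exprVn b 1 (ltr0Sn R 1); rewrite !expr1.
have u0 : (0 < (2 ^+ j.+1)^-1 :> R)%R by rewrite invr_gt0.
rewrite !powRN powRM ?(ltW t0) ?(ltW u0)//.
have ub0 : (0 < (2 ^+ j.+1)^-1 `^ b :> R)%R by rewrite powR_gt0.
rewrite le_eqVlt; apply/orP; left; apply/eqP; field.
by rewrite !gt_eqF.
Qed.

(** The dilation in the j-th term costs 2^(j+1), which cancels the first factor
    of its coefficient and leaves the geometric series in B < 1. *)
Lemma norm_of_weighted_average :
  norm_of rhobar (fun t => (t `^ (- b))%:E * rearr_avg mu f t) <=
  (B / (1 - B) * (a / (1 - r)))%:E * Ng.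
Proof.
have B0 : (0 <= B)%R by case/andP: B01.
have mF := measurable_weighted.
have p2 k : (0 < 2 ^+ k :> R)%R by rewrite exprn_gt0.
have c0 j : (0 <= 2 ^- j.+1 * B ^+ j.+1)%R by rewrite mulr_ge0 ?exprn_ge0// invr_ge0 ltW.
have NF0 : 0 <= norm_of rhobar F by exact: (norm_of_ge0 hri).
pose H j (t : measurableTypeR R) := (2 ^- j.+1 * B ^+ j.+1)%:E * F (t / 2 ^+ j.+1).
have mFj j : measurable_fun [set: measurableTypeR R] (fun t => F (t / 2 ^+ j.+1)).
  exact: measurable_dilate.
have MH j : Mplus (H j).
  split => [|x]; last by rewrite mule_ge0// lee_fin.
  exact: measurable_funeM.
have I0 t : 0 <= \int[@lebesgue_measure R]_(z in `]0%R, t[) f' z by exact: integral_ge0.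
have mI : measurable_fun [set: measurableTypeR R]
    (fun t => \int[@lebesgue_measure R]_(z in `]0%R, t[) f' z).
  apply: nondecreasing_measurable_ereal => x y xy; apply: ge0_subset_integral => //.
    exact: measurable_funS (measurable_rearr _ _).
  by move=> z /=; rewrite !in_itv/= => /andP[-> zx]; exact: lt_le_trans xy.
pose G (t : measurableTypeR R) := `|(t `^ (- b))%:E * rearr_avg mu f t|.
have mG : measurable_fun [set: measurableTypeR R] G.
  apply: measurableT_comp => //; apply: emeasurable_funM.
    by apply/measurable_EFinP; exact: measurable_powR.
  (* For t < 0 the integral is over an empty interval, so the inverse may be
     replaced by a power, a measurable function of t on the whole line. *)
  have -> : rearr_avg mu f = (fun t => (t `^ (-1))%:E * \int[@lebesgue_measure R]_(z in `]0%R, t[) f' z).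
    apply/funext => t; rewrite /rearr_avg; have [t0|t0] := leP 0%R t.
      by rewrite powR_inv1.
    by rewrite set_itv_ge ?bnd_simp -?leNgt ?(ltW t0)// integral_set0 !mule0.
  apply: emeasurable_funM => //.
  by apply/measurable_EFinP; exact: measurable_powR.
have -> : norm_of rhobar (fun t => (t `^ (- b))%:E * rearr_avg mu f t) = norm_of rhobar G.
  by congr rhobar; apply/funext => t; rewrite /= abse_id.
apply: le_trans (@norm_of_le_series _ _ hri G H mG MH _ _) _.
- by move=> t; exact: abse_ge0.
- move=> t t0; rewrite /G gee0_abs; first exact: weighted_average_le.
  rewrite mule_ge0// ?lee_fin ?powR_ge0// /rearr_avg mule_ge0// lee_fin.
  by rewrite invr_ge0 ltW.
apply: (@le_trans _ _ ((B / (1 - B))%:E * norm_of rhobar F)); last first.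
  rewrite [in leRHS]EFinM -muleA lee_wpmul2l//; last exact: norm_of_weighted.
  by case/andP: B01 => _ B1; rewrite lee_fin divr_ge0// subr_ge0 ltW.
apply: le_trans (geometric_series_le B0 B01 NF0).
apply: lee_nneseries => [j _ _|j _].
  by apply: (norm_of_ge0 hri); case: (MH j).
rewrite (norm_of_scale hri)//.
apply: le_trans (lee_wpmul2l _ (norm_of_dilate_two_iter hri j.+1 mF F0 weighted_nonincreasing)) _.
  by rewrite lee_fin.
rewrite muleA -EFinM lee_wpmul2r// lee_fin mulrAC mulVf ?gt_eqF// mul1r.
by rewrite exprS.
Qed.

End lower.

End consequences.

(** * The embedding theorem *)
Section embeddings.
Context (R : realType) (d : measure_display) (T : metricMeasurableType d R).
Context (mu : {measure set T -> \bar R}) (c alpha s : R).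
Context (rho : (T -> \bar R) -> \bar R) (rhobar : (R -> \bar R) -> \bar R).
Hypotheses (hmu : metric_measure_space mu) (hc : (1 <= c)%R).
Hypotheses (hac : almost_continuous mu c) (halpha : (0 < alpha)%R).
Hypotheses (hlb : lower_bounded mu alpha) (hs : (0 < s)%R).
Hypothesis hXbar : represents mu rho rhobar.

Local Notation b := (s / alpha)%R.
Local Notation K := (2 * (3 * c) `^ b)%R.
Let hri : ri_norm (leb_half_line R) rhobar := repr_ri hXbar.

Let b0 : (0 < b)%R. Proof. exact: divr_gt0. Qed.
Let K0 : (0 < K)%R.
Proof. by rewrite mulr_gt0// powR_gt0// mulr_gt0// (lt_le_trans ltr01). Qed.

Lemma s_gradient_rearr (f g : T -> R) :
  hajlasz_space mu s rho f -> s_gradient mu s rho f g ->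
  [/\ measurable_fun [set: T] f, measurable_fun [set: T] (EFin \o g),
    norm_of rhobar (rearr mu (EFin \o f)) < +oo,
    norm_of rho (EFin \o g) = norm_of rhobar (rearr mu (EFin \o g)) /\
      norm_of rhobar (rearr mu (EFin \o g)) < +oo &
    forall z t : R, (0 < z)%R -> (z <= t)%R ->
      rearr mu (EFin \o f) z <=
      rearr mu (EFin \o f) t + (K * t `^ b)%:E * rearr mu (EFin \o g) z].
Proof.
move=> [[mf fN] _] [[mg gN] g0 [N N0 fgN]].
rewrite -!(repr_norm hXbar)//; split => //; first exact/measurable_EFinP.
move=> z t z0 zt; apply: (rearr_gradient_le hmu hac hc halpha hs hlb _ _ g0 N0 fgN z0 zt);
  exact/measurable_EFinP.
Qed.

(** The norm of f in L1 + Linfty enters because it bounds the rearrangement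
    at 1, the starting point of the telescoping. *)
Lemma Linfty_embedding (sigma q : R) : (1 < sigma)%R -> (0 <= q)%R ->
  (q < sigma `^ b)%R -> dilation_norm rhobar sigma <= q%:E ->
  exists2 C : R, (0 < C)%R & forall f g : T -> R,
    hajlasz_space mu s rho f -> s_gradient mu s rho f g ->
    'N[mu]_+oo[EFin \o f] <=
      C%:E * (norm_of rho (EFin \o g) + norm_L1_plus_Linfty mu f).
Proof.
move=> s1 q0 qs hq.
set r := (q / sigma `^ b)%R.
pose C := (K * q / fine (fundamental_function rhobar 1) / (1 - r))%R.
have [_ phi0] := fundamental_function1E hri.
have r1 : (0 < 1 - r)%R.
  by rewrite subr_gt0 ltr_pdivrMr ?mul1r// powR_gt0// (lt_trans ltr01).
have C0 : (0 <= C)%R by rewrite divr_ge0 ?(ltW r1)// divr_ge0 ?(ltW phi0)// mulr_ge0// ltW.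
exists (C + 1)%R; first by rewrite ltr_wpDl.
move=> f g hf hg; have [mf mg fN [gE gN] fg] := s_gradient_rearr hf hg.
have mEf : measurable_fun [set: T] (EFin \o f) by exact/measurable_EFinP.
set Ng := norm_of rho (EFin \o g).
set L := norm_L1_plus_Linfty mu f.
have f1L : rearr mu (EFin \o f) 1 <= L := rearr1_le_L1_plus_Linfty mu f.
have L0 : 0 <= L := le_trans (rearr_ge0 _ _ _) f1L.
have Ng0 : 0 <= Ng by rewrite /Ng gE; apply: (norm_of_ge0 hri); exact: measurable_rearr.
have bound n : rearr mu (EFin \o f) (sigma^-1 ^+ n) <=
    rearr mu (EFin \o f) 1 + C%:E * Ng.
  by rewrite /Ng gE; exact: (rearr_bounded hri mg gN K0 fg s1 q0 qs hq).
have f1fin : rearr mu (EFin \o f) 1 \is a fin_num.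
  exact: (rearr_fin_num hri fN ltr01).
have Ngfin : Ng \is a fin_num by rewrite ge0_fin_numE// /Ng gE.
pose M := (fine (rearr mu (EFin \o f) 1) + C * fine Ng)%R.
have ME : rearr mu (EFin \o f) 1 + C%:E * Ng = M%:E.
  by rewrite /M EFinD (EFinM C) !fineK.
apply: (@le_trans _ _ M%:E).
  apply: (@Lnorm_infty_le_rearr _ _ _ _ _ sigma^-1) => //.
  - by rewrite invr_ge0 (ltW (lt_trans ltr01 s1))/= invf_lt1// (lt_trans ltr01).
  - by rewrite -lee_fin -ME adde_ge0 ?rearr_ge0// mule_ge0// lee_fin.
  - by move=> n; rewrite -ME.
rewrite -ME ge0_muleDr// addeC; apply: leeD.
  by rewrite lee_wpmul2r// lee_fin lerDl.
apply: (le_trans f1L); rewrite -[leLHS]mul1e lee_wpmul2r// lee_fin.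
by rewrite lerDr.
Qed.

Lemma upper_boyd_embedding : exists2 C : R, (0 < C)%R &
  upper_boyd rhobar < b%:E -> forall f g : T -> R,
    hajlasz_space mu s rho f -> s_gradient mu s rho f g ->
    'N[mu]_+oo[EFin \o f] <=
      C%:E * (norm_of rho (EFin \o g) + norm_L1_plus_Linfty mu f).
Proof.
have [h|] := pselect (upper_boyd rhobar < b%:E); last by exists 1%R.
have [sigma [q [s1 q0 qs hq]]] := upper_boyd_lt h.
by have [C C0 HC] := Linfty_embedding s1 q0 qs hq; exists C.
Qed.

(** Since 2 < 2^b, the dilation by 2 takes over the role of the Boyd index. *)
Lemma supercritical_embedding : exists2 C : R, (0 < C)%R &
  (1 < b)%R -> forall f g : T -> R,
    hajlasz_space mu s rho f -> s_gradient mu s rho f g ->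
    'N[mu]_+oo[EFin \o f] <=
      C%:E * (norm_of rho (EFin \o g) + norm_L1_plus_Linfty mu f).
Proof.
have [b1|] := pselect (1 < b)%R; last by exists 1%R.
have q2 : (2 < 2 `^ b :> R)%R.
  rewrite -[ltRHS](mulr_powRB1 _ b0)// ltr_pMr//.
  have b10 : (0 < b - 1)%R by rewrite subr_gt0.
  apply: (@le_lt_trans _ _ (1 `^ (b - 1))%R); first by rewrite powR1.
  by apply: gt0_ltr_powR; rewrite ?nnegrE// ltr1n.
have [C C0 HC] := Linfty_embedding (ltr1n R 2) (ler0n R 2) q2 (dilation_norm_two_le hri).
by exists C.
Qed.

Lemma lower_boyd_embedding : exists2 C : R, (0 < C)%R &
  b%:E < lower_boyd rhobar -> forall f g : T -> R,
    hajlasz_space mu s rho f -> s_gradient mu s rho f g ->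
    norm_of rhobar
      (fun t => (t `^ (- b))%:E * rearr_avg mu (EFin \o f) t) <=
    C%:E * norm_of rho (EFin \o g).
Proof.
have [h|] := pselect (b%:E < lower_boyd rhobar); last by exists 1%R.
have [sigma [q [s01 q0 qs hq]]] := lower_boyd_gt h.
set B := ((2^-1 : R) `^ b)%R; set r := (q / sigma `^ b)%R.
pose C := (B / (1 - B) * (K / sigma `^ b / (1 - r)))%R.
exists (Num.max 1 C)%R; first by rewrite lt_max ltr01.
move=> _ f g hf hg; have [mf mg fN [gE gN] fg] := s_gradient_rearr hf hg.
have mEf : measurable_fun [set: T] (EFin \o f) by exact/measurable_EFinP.
have Ng0 : 0 <= norm_of rho (EFin \o g).
  by rewrite gE; apply: (norm_of_ge0 hri); exact: measurable_rearr.
apply: (@le_trans _ _ (C%:E * norm_of rho (EFin \o g))).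
  by rewrite gE; exact: (norm_of_weighted_average hri mEf mg fN gN K0 b0 fg s01 q0 qs hq).
by rewrite lee_wpmul2r// lee_fin le_max lexx orbT.
Qed.

End embeddings.

Theorem theorem6 (R : realType) (d : measure_display)
  (Omega : metricMeasurableType d R) (mu : {measure set Omega -> \bar R})
  (c alpha s : R)
  (rho : (Omega -> \bar R) -> \bar R) (rhobar : (R -> \bar R) -> \bar R)
  (hmu : metric_measure_space mu)
  (hc : (1 <= c)%R) (hac : almost_continuous mu c)
  (halpha : (0 < alpha)%R) (hlb : lower_bounded mu alpha)
  (hs : (0 < s)%R)
  (hX : ri_norm mu rho) (hXbar : represents mu rho rhobar) :
  exists2 C : R, (0 < C)%R &
  forall f g : Omega -> R, hajlasz_space mu s rho f -> s_gradient mu s rho f g ->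
  [/\ (s / alpha < 1)%R ->
        ((s / alpha)%:E < lower_boyd rhobar ->
           norm_of rhobar
             (fun t => (t `^ (- (s / alpha)))%:E * rearr_avg mu (EFin \o f) t)
           <= C%:E * norm_of rho (EFin \o g)) /\
        (upper_boyd rhobar < (s / alpha)%:E ->
           'N[mu]_+oo[EFin \o f] <=
             C%:E * (norm_of rho (EFin \o g) + norm_L1_plus_Linfty mu f)),
      (s / alpha = 1)%R ->
        ereal_sup [set fundamental_function rhobar t *
            ((rearr_avg mu (EFin \o f) t - rearr mu (EFin \o f) t) * (t^-1)%:E) |
            t in [set t : R | (0 < t)%R]]
        <= C%:E * norm_of rho (EFin \o g) &
      (1 < s / alpha)%R ->
        'N[mu]_+oo[EFin \o f] <=
          C%:E * (norm_of rho (EFin \o g) + norm_L1_plus_Linfty mu f)].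
Proof.
have hri := repr_ri hXbar.
have [C1 C10 H1] := lower_boyd_embedding hmu hc hac halpha hlb hs hXbar.
have [C2 C20 H2] := upper_boyd_embedding hmu hc hac halpha hlb hs hXbar.
have [C3 C30 H3] := supercritical_embedding hmu hc hac halpha hlb hs hXbar.
pose K := (2 * (3 * c) `^ (s / alpha))%R.
have K0 : (0 < K)%R.
  by rewrite mulr_gt0// powR_gt0// mulr_gt0// (lt_le_trans ltr01).
exists (C1 + C2 + C3 + K)%R; first by rewrite !addr_gt0.
move=> f g hf hg.
have [mf mg fN [gE gN] fg] := s_gradient_rearr hmu hc hac halpha hlb hs hXbar hf hg.
have mEf : measurable_fun [set: Omega] (EFin \o f) by exact/measurable_EFinP.
have Ng0 : 0 <= norm_of rho (EFin \o g).
  by rewrite gE; apply: (norm_of_ge0 hri); exact: measurable_rearr.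
have L0 : 0 <= norm_L1_plus_Linfty mu f.
  exact: le_trans (rearr_ge0 _ _ _) (rearr1_le_L1_plus_Linfty mu f).
have mono (C : R) (x y : \bar R) : (C <= C1 + C2 + C3 + K)%R -> 0 <= y ->
    x <= C%:E * y -> x <= (C1 + C2 + C3 + K)%:E * y.
  by move=> CC y0 /le_trans; apply; rewrite lee_wpmul2r// lee_fin.
split => [_|b1|b1].
- split=> [h|h].
  + by apply: (mono C1); [lra|by []|exact: H1].
  + by apply: (mono C2); [lra|exact: adde_ge0|exact: H2].
- apply: (mono K); [lra|by []|].
  by rewrite gE; exact: (oscillation_le hri fN K0 fg b1).
- by apply: (mono C3); [lra|exact: adde_ge0|exact: H3].
Qed.
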